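(* Assume the Hardy-Littlewood Conjecture. Let $\alpha$ be an integer with $\alpha\equiv 1\pmod 4$, let $D=\pm 2^\sigma p_1\cdots p_r(q_1\cdots q_s)^2(l_1\cdots l_t)^3$, and let $d,\bar d$ and the associated quantities be as in the context. Put $$e=r_3'+r_5'+t_3'+t_5'+r_1''+r_7''+t_1''+t_7''+s''.$$ (1) Assume $D$ is odd. If $D\equiv 1\pmod 4$, then $$\mathrm{dens}_D(2\alpha)=\frac14\left(1+\frac{(-1)^{r''+t''}}{\prod_{l\mid \bar d_p\bar d_l}\tau(l)}+\frac{2(-1)^{e}}{\prod_{l\mid \bar d_p\bar d_q\bar d_l}\tau(l)}\right),\qquad \mathrm{dens}_D(-2\alpha)=\frac14\left(1+\frac{(-1)^{r''+t''}}{\prod_{l\mid \bar d_p\bar d_l}\tau(l)}-\frac{2(-1)^{e}}{\prod_{l\mid \bar d_p\bar d_q\bar d_l}\tau(l)}\right).$$ If $D\equiv 3\pmod 4$, then $$\mathrm{dens}_D(2\alpha)=\mathrm{dens}_D(-2\alpha)=\frac14\left(1+\frac{(-1)^{r''+t''}}{\prod_{l\mid \bar d_p\bar d_l}\tau(l)}\right).$$ (2) Assume $D$ is even. If $4\parallel D$ and $\frac D4\equiv 1\pmod 4$, then $$\mathrm{dens}_D(2\alpha)=\mathrm{dens}_D(-2\alpha)=\frac14\left(1+\frac{(-1)^{r''+t''}}{\prod_{l\mid \bar d_p\bar d_l}\tau(l)}\right).$$ If $4\parallel D$ and $\frac D4\equiv 3\pmod 4$, then $$\mathrm{dens}_D(2\alpha)=\frac14\left(1+\frac{(-1)^{r''+t''}}{\prod_{l\mid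 \bar d_p\bar d_l}\tau(l)}+\frac{2(-1)^{e}}{\prod_{l\mid \bar d_p\bar d_q\bar d_l}\tau(l)}\right),\qquad \mathrm{dens}_D(-2\alpha)=\frac14\left(1+\frac{(-1)^{r''+t''}}{\prod_{l\mid \bar d_p\bar d_l}\tau(l)}-\frac{2(-1)^{e}}{\prod_{l\mid \bar d_p\bar d_q\bar d_l}\tau(l)}\right).$$ If $2\parallel D$ or $8\parallel D$, then $\mathrm{dens}_D(2\alpha)=\mathrm{dens}_D(-2\alpha)=\frac14$.
   Context: $D=\pm 2^\sigma p_1\cdots p_r(q_1\cdots q_s)^2(l_1\cdots l_t)^3$ with $\sigma\in\{0,1,2,3\}$, $r,s,t\ge0$, and the $p_i,q_i,l_i$ pairwise distinct odd primes. Write $D=d\bar d$ with $\gcd(d,\bar d)=1$, $d>0$ odd, every prime factor of $d$ dividing $\alpha$, and $\gcd(\alpha,\bar d)=1$. Write $d=d_pd_q^2d_l^3$ and $\bar d=\pm2^\sigma\bar d_p\bar d_q^2\bar d_l^3$ with $d_p,d_q,d_l,\bar d_p,\bar d_q,\bar d_l$ positive, odd, squarefree and pairwise coprime. $r'',s'',t''$ are the numbers of prime factors of $\bar d_p,\bar d_q,\bar d_l$ respectively; $r_i',r_i'',t_i',t_i''$ are the numbers of prime factors congruent to $i$ mod $8$ of $d_p,\bar d_p,d_l,\bar d_l$ respectively. Products over $l$ run over primes $l$ (empty products are $1$), with $\tau(l)=l$ if $l\equiv3\pmod4$ and $\tau(l)=l-2$ if $l\equiv1\pmod4$. $2^k\parallel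 D$ means $2^k\mid D$ and $2^{k+1}\nmid D$. For a nonzero integer $D$, $E_D$ is the elliptic curve $y^2=x^3+Dx$, and for a prime $p\nmid 2D$, $a_p(E_D)=1+p-\#\tilde E_D(\mathbb{F}_p)$. For a nonzero integer $m$ put $Q(m,N)=\{p \text{ prime}: p=m^2+x^2\le N \text{ for some } x\in\mathbb{Z}\}$ and $$\mathrm{dens}_D(2m)=\lim_{N\to\infty}\frac{\#\{p\in Q(m,N): p\nmid 2D,\ a_p(E_D)=2m\}}{\#Q(m,N)}$$ (denoted $a_p(2m)$ in the paper); the claim includes that the limits exist. Hardy-Littlewood Conjecture: for all integers $a,b,c$ with $a>0$, $\gcd(a,b,c)=1$, $a+b$ and $c$ not both even, and $\Delta=b^2-4ac$ not a perfect square, the number $P(n)$ of primes less than $n$ of the form $ax^2+bx+c$ (with $x$ a nonnegative integer) satisfies $P(n)\sim\delta(a,b,c)\frac{\sqrt{n}}{\log n}$ as $n\to\infty$, where $$\delta(a,b,c)=\frac{\gcd(2,a+b)}{\sqrt{a}}\prod_{p\mid a,\ p\mid b,\ p>2}\frac{p}{p-1}\ \prod_{p\nmid a,\ p>2}\left(1-\frac{\left(\frac{\Delta}{p}\right)}{p-1}\right),$$ the products being over primes (the second taken in increasing order of $p$) and $\left(\frac{\cdot}{p}\right)$ being the Legendre symbol. *)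

(* Defs.v *)
From mathcomp Require Import all_boot all_order all_algebra.
From mathcomp Require Import all_classical all_reals all_analysis.
Import numFieldNormedType.Exports.
Set Implicit Arguments.
Unset Strict Implicit.
Unset Printing Implicit Defensive.
Import Order.TTheory GRing.Theory Num.Theory.
Local Open Scope classical_set_scope.
Local Open Scope ring_scope.

(** Affine points of y^2 = x^3 + D x over F_p together with the point at
    infinity.  ['F_p] is the field with p elements only when p is prime. *)
Definition card_E (D : int) (p : nat) : nat :=
  #|[set xy : 'F_p * 'F_p | xy.2 ^+ 2 == xy.1 ^+ 3 + D%:~R * xy.1]%SET|.+1.

Definition trace_E (D : int) (p : nat) : int := 1 + p%:Z - (card_E D p)%:Z.

Definition Q (m : int) (N : nat) : {set 'I_N.+1} :=
  [set p : 'I_N.+1 | prime p && `[< exists x : int, p%:Z = m ^+ 2 + x ^+ 2 >]]%SET.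

Definition Q_trace (D m : int) (N : nat) : {set 'I_N.+1} :=
  [set p in Q m N | ~~ (p%:Z %| 2 * D)%Z && (trace_E D p == 2 * m)]%SET.

(** [dens R D m delta] : the limit written dens_D(2m) exists and is [delta]. *)
Definition dens (R : realType) (D m : int) (delta : R) : Prop :=
  (fun N : nat => #|Q_trace D m N|%:R / #|Q m N|%:R : R) @ \oo --> delta.

(** Meaningful for p an odd prime. *)
Definition legendre (a : int) (p : nat) : int :=
  if (p%:Z %| a)%Z then 0
  else if [exists x : 'F_p, x ^+ 2 == a%:~R] then 1 else -1.

Definition disc (a b c : int) : int := b ^+ 2 - 4 * a * c.

(** The product over p not dividing a is only conditionally convergent, so it
    is the limit of its partial products in increasing order of p. *)
Definition HL_delta (R : realType) (a b c : int) : R :=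
  (gcdz 2 (a + b))%:~R / Num.sqrt a%:~R
  * (\prod_(p <- primes `|a| | (p%:Z %| b)%Z && (2 < p)%N) (p%:R / (p%:R - 1)))
  * limn (fun n : nat =>
      \prod_(p < n | [&& prime p, (2 < p)%N & ~~ (p%:Z %| a)%Z])
         (1 - (legendre (disc a b c) p)%:~R / (p%:R - 1)) : R).

Definition HL_count (a b c : int) (n : nat) : nat :=
  #|[set p : 'I_n | prime p &&
      `[< exists x : nat, p%:Z = a * x%:Z ^+ 2 + b * x%:Z + c >]]%SET|.

Definition Hardy_Littlewood (R : realType) : Prop :=
  forall a b c : int,
    0 < a -> gcdz (gcdz a b) c = 1 ->
    ~ ((2 %| a + b)%Z /\ (2 %| c)%Z) ->
    ~ (exists k : int, disc a b c = k ^+ 2) ->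
    (fun n : nat => (HL_count a b c n)%:R /
       (HL_delta R a b c * (Num.sqrt n%:R / ln n%:R)) : R) @ \oo --> (1 : R).

Definition squarefree (n : nat) : Prop :=
  forall p : nat, prime p -> ~~ (p ^ 2 %| n)%N.

Definition odd_squarefree (n : nat) : Prop :=
  [/\ (0 < n)%N, odd n & squarefree n].

(** [neg] is the sign of D. *)
Definition standard_form (D : int) (neg : bool) (sigma : nat)
    (ps qs ls : seq nat) : Prop :=
  [/\ (sigma <= 3)%N,
      all (fun p => prime p && odd p) (ps ++ qs ++ ls),
      uniq (ps ++ qs ++ ls)
    & D = (-1) ^+ neg * 2 ^+ sigma * (\prod_(p <- ps) p)%N%:Z
          * (\prod_(q <- qs) q)%N%:Z ^+ 2 * (\prod_(l <- ls) l)%N%:Z ^+ 3].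

(** D = d * d' with d the part of D supported on the primes dividing alpha,
    d = dp * dq ^ 2 * dl ^ 3 and d' = +-2^sigma * dp' * dq' ^ 2 * dl' ^ 3. *)
Definition alpha_splitting (alpha D : int) (neg : bool) (sigma : nat)
    (d : nat) (d' : int) (dp dq dl dp' dq' dl' : nat) : Prop :=
  [/\ D = d%:Z * d', coprimez d%:Z d', (0 < d)%N & odd d]
  /\ (forall p : nat, prime p -> (p %| d)%N -> (p%:Z %| alpha)%Z)
  /\ coprimez alpha d'
  /\ d = (dp * dq ^ 2 * dl ^ 3)%N
  /\ d' = (-1) ^+ neg * 2 ^+ sigma * dp'%:Z * dq'%:Z ^+ 2 * dl'%:Z ^+ 3
  /\ (forall n, n \in [:: dp; dq; dl; dp'; dq'; dl'] -> odd_squarefree n)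
  /\ pairwise coprime [:: dp; dq; dl; dp'; dq'; dl'].

Definition nprimes (n : nat) : nat := size (primes n).

Definition nprimes8 (i n : nat) : nat :=
  count (fun p => p %% 8 == i)%N (primes n).

(** Only used at odd primes; for l = 1 mod 4 the subtraction does not truncate. *)
Definition tau (l : nat) : nat := (if l %% 4 == 3 then l else l - 2)%N.

Definition prod_tau (n : nat) : nat := (\prod_(l <- primes n) tau l)%N.

Definition exactly_divides (k : nat) (D : int) : Prop :=
  (2 ^+ k %| D)%Z && ~~ (2 ^+ k.+1 %| D)%Z.

(* Main.v *)
Require Import Defs.
From mathcomp Require Import all_boot all_order all_algebra all_field cyclic.
From mathcomp Require Import zify ring lra.
From mathcomp Require Import all_classical all_reals all_analysis.
Set Implicit Arguments.
Unset Strict Implicit.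
Unset Printing Implicit Defensive.
Import Order.TTheory GRing.Theory Num.Theory.
Import numFieldNormedType.Exports.
Local Open Scope ring_scope.

(** Write [a] for [alpha] and let [p = a ^ 2 + x ^ 2] be a prime not dividing
    [2 D].  As [a] is odd, [x] is even and [p = 1 mod 4].  Put [f = x / a]
    modulo [p], a square root of -1, and let [chi] be the quartic character of
    ['F_p] normalized by [chi y = i ^ k] when [y ^ ((p - 1) / 4) = f ^ k].

    The trace.  Splitting the point count of [y ^ 2 = x ^ 3 + D x] according to
    squares turns it into two Jacobi sums, and the Jacobi sum [J(chi, chi)] is
    [- (a + x i)]: it has norm [p], it vanishes modulo [a + x i], and pairing
    [y] with [1 - y] fixes its class modulo 4 ([jacobi_two_squares]).  Hence the
    trace is [chi(D)^-1 (a + x i) + chi(D) (a - x i)], which is [2 a] exactly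
    when [D] is a fourth power modulo [p], and [- 2 a] exactly when [chi(D) = -1]
    ([trace_eq_2alpha], [trace_eq_N2alpha]).

    Reciprocity.  Raising the quartic Gauss sum to the power [q] in
    characteristic [q], and using that its fourth power is
    [(a + x i) ^ 3 (a - x i)], expresses [chi (q)] or [chi (- q)], whichever
    argument is 1 modulo 4, as a power of [(a + x i) / (a - x i)] in a field of
    characteristic [q] ([locsym_reciprocity]).  Together with
    [chi (-1) = i ^ x] and [chi 2 = i ^ (x / 2)] ([quartic_neg1],
    [quartic_two]) this shows that [chi D] depends only on [x] modulo
    [M = 8 * (product of the odd primes dividing D)], and that it is a product
    of functions of [x] modulo the factors of [M].

    Local averages.  If [q] does not divide [a], then [(a + x i) / (a - x i)]
    runs through the cyclic group of order [q - 1] or [q + 1] (order divisible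
    by 4) except for the element [-1], while [x] runs through the residues with
    [a ^ 2 + x ^ 2 != 0].  A nontrivial character sums to zero over the group,
    so its sum over these residues is minus its value at [-1], and the number
    of residues is [tau q].  If [q] divides [a], the quotient is constantly [-1]
    ([local_sum_unramified], [local_sum_ramified]).  By the Chinese remainder
    theorem and orthogonality this counts the classes modulo [M] on which
    [chi D] is [1] or [-1] ([card_class_exp]).

    Equidistribution.  For [r] in a class prime to [M], the primes
    [a ^ 2 + (r + M k) ^ 2] are the primes represented by a quadratic polynomial
    in [k], and its Hardy-Littlewood constant does not depend on [r].  So these
    classes contain asymptotically equally many primes, the other classes
    contain boundedly many, and the density is the proportion of classes
    ([density_of_classes]). *)

(** * Powers of a square root of -1 *)

Lemma expi_mod4 (K : comPzRingType) (i : K) (hi : i ^+ 2 = -1) (n : nat) :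
  i ^+ (n %% 4) = i ^+ n.
Proof.
have hi4 : i ^+ 4 = 1 by rewrite -[4%N]/(2 * 2)%N exprM hi sqrrN expr1n.
by rewrite {2}(divn_eq n 4) exprD mulnC exprM hi4 expr1n mul1r.
Qed.

Lemma expi_eq1 (K : fieldType) (i : K) (hi : i ^+ 2 = -1)
    (h2 : (2 : K) != 0) (n : nat) :
  (i ^+ n == 1) = (4 %| n)%N.
Proof.
have hN1 : (-1 : K) != 1.
  apply: contraNneq h2 => h; by rewrite -[2]/(1 + 1 : K) -{1}h addNr eqxx.
rewrite -(expi_mod4 hi) /dvdn.
have : (n %% 4 < 4)%N by rewrite ltn_mod.
case: (n %% 4)%N => [|[|[|[|k]]]] hk; last by [].
- by rewrite expr0 !eqxx.
- rewrite expr1; apply/negbTE; apply: contraNneq hN1 => h.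
  by rewrite -hi h expr1n.
- by rewrite hi; apply/negbTE.
- rewrite exprS hi mulrN1; apply/negbTE; apply: contraNneq hN1 => h.
  by rewrite -hi -sqrrN h expr1n.
Qed.

Lemma expi_neq0 (K : fieldType) (i : K) (hi : i ^+ 2 = -1) (n : nat) :
  i ^+ n != 0.
Proof.
rewrite expf_neq0 //; apply/eqP => h; move/eqP: hi.
by rewrite h expr0n /= eq_sym oppr_eq0 oner_eq0.
Qed.

Lemma expi_inj (K : fieldType) (i : K) (hi : i ^+ 2 = -1)
    (h2 : (2 : K) != 0) (a b : nat) :
  i ^+ a = i ^+ b <-> a = b %[mod 4].
Proof.
split=> [h|h]; last by rewrite -(expi_mod4 hi) h expi_mod4.
wlog le_ab: a b h / (a <= b)%N.
  by move=> H; case: (leqP a b) => [/H->//|/ltnW/H->].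
have /eqP : i ^+ (b - a) = 1.
  apply: (mulIf (expi_neq0 hi a)); rewrite mul1r -exprD subnK //.
by rewrite expi_eq1 // => h4; apply/eqP; rewrite eq_sym eqn_mod_dvd.
Qed.

(** Discrete logarithm to the base [i] on the fourth roots of unity.  Residue
    symbols are compared through these exponents, because their values live in
    fields of different characteristics. *)
Definition qlog (K : fieldType) (i y : K) : nat :=
  if y == 1 then 0 else if y == i then 1 else if y == -1 then 2 else 3.

Lemma qlogK (K : fieldType) (i y : K) (hi : i ^+ 2 = -1) :
  y ^+ 4 = 1 -> i ^+ qlog i y = y.
Proof.
move=> hy; rewrite /qlog; case: eqP => [->|/eqP h1]; first by [].
case: eqP => [->|/eqP h2] //; case: eqP => [->|/eqP h3] //.
have : (y - 1) * (y - i) * (y + 1) * (y + i) == 0.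
  have -> : (y - 1) * (y - i) * (y + 1) * (y + i)
     = y ^+ 4 - y ^+ 2 * (i ^+ 2 + 1) + i ^+ 2 by ring.
  by rewrite hi hy; apply/eqP; ring.
rewrite !mulf_eq0 !subr_eq0 (negbTE h1) (negbTE h2) !addr_eq0 (negbTE h3) /=.
by move/eqP->; rewrite exprS hi mulrN1.
Qed.

Lemma qlog_expi (K : fieldType) (i : K) (hi : i ^+ 2 = -1)
    (h2 : (2 : K) != 0) (n : nat) : qlog i (i ^+ n) = n %[mod 4].
Proof.
apply/(expi_inj hi h2); apply: qlogK => //.
by rewrite -exprM mulnC exprM -[4%N]/(2 * 2)%N exprM hi sqrrN !expr1n.
Qed.

(** * Gauss and Jacobi sums *)

Section GaussSums.
Variables (p : nat) (K : fieldType) (z : K).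
Hypotheses (p_pr : prime p) (zp : z ^+ p = 1) (z1 : z != 1).

Definition ach (y : 'F_p) : K := z ^+ (y : nat).

Lemma achD x y : ach (x + y) = ach x * ach y.
Proof.
have zT : z ^+ (Zp_trunc (pdiv p)).+2 = 1 by rewrite Fp_cast.
rewrite /ach -exprD /=.
rewrite [in RHS](divn_eq (x + y) (Zp_trunc (pdiv p)).+2) exprD mulnC exprM.
by rewrite zT expr1n mul1r.
Qed.

Lemma ach0 : ach 0 = 1. Proof. by []. Qed.

(** Translation by 1 multiplies the sum by [z != 1]. *)
Lemma sum_ach (t : 'F_p) :
  \sum_y ach (t * y) = if t == 0 then p%:R else 0.
Proof.
case: eqP => [->|/eqP t0].
  under eq_bigr => y _ do rewrite mul0r ach0.
  by rewrite sumr_const card_Fp.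
have -> : \sum_y ach (t * y) = \sum_y ach y.
  by rewrite [RHS](reindex_inj (mulfI t0)).
have z10 : z - 1 != 0 by rewrite subr_eq0.
apply: (mulfI z10); rewrite mulr0 mulrBl mul1r.
have -> : z = ach 1 by rewrite /ach /= ?modn_small ?expr1 //.
rewrite mulr_sumr.
under eq_bigr => y _ do rewrite -achD.
by rewrite [X in _ - X](reindex_inj (addrI 1)) subrr.
Qed.

(** The value 0 at 0 lets all sums below range over the whole of ['F_p]. *)
Definition mulchar (c : 'F_p -> K) :=
  [/\ c 0 = 0, c 1 = 1 & {morph c : x y / x * y}].

Definition nontrivial (c : 'F_p -> K) := exists2 t, t != 0 & c t != 1.

Definition gauss (c : 'F_p -> K) : K := \sum_y c y * ach y.
Definition jacobi (c c' : 'F_p -> K) : K := \sum_y c y * c' (1 - y).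

(** Multiplication by [t] with [c t != 1] multiplies the sum by [c t]. *)
Lemma mulchar_sum c : mulchar c -> nontrivial c -> \sum_y c y = 0.
Proof.
move=> [c0 c1 cM] [t t0 ct].
have h : c t - 1 != 0 by rewrite subr_eq0.
apply: (mulfI h); rewrite mulr0 mulrBl mul1r mulr_sumr.
under eq_bigr => y _ do rewrite -cM.
by rewrite [X in _ - X](reindex_inj (mulfI t0)) subrr.
Qed.

Lemma gauss_shift c t : mulchar c -> t != 0 ->
  c t * \sum_y c y * ach (t * y) = gauss c.
Proof.
move=> [c0 c1 cM] t0; rewrite /gauss mulr_sumr [RHS](reindex_inj (mulfI t0)).
by apply: eq_bigr => y _; rewrite cM mulrA.
Qed.

(** The identity [c' x * gauss c = \sum_y c y * ach (x * y)] holds also at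
    [x = 0], since [c] is nontrivial.  Summing it against [ach x] over [x] first
    leaves only [y = -1]. *)
Lemma gauss_mul_inv c c' : mulchar c -> mulchar c' -> nontrivial c ->
  (forall y, y != 0 -> c y * c' y = 1) ->
  gauss c * gauss c' = c (-1) * p%:R.
Proof.
move=> hc hc' nc cc'; rewrite mulrC {1}/gauss mulr_suml.
have h x : c' x * gauss c = \sum_y c y * ach (x * y).
  case: (eqVneq x 0) => [->|x0].
    case: hc' => -> _ _; rewrite mul0r.
    under eq_bigr => y _ do rewrite mul0r ach0 mulr1.
    by rewrite mulchar_sum.
  by rewrite -(gauss_shift hc x0) mulrA [c' x * _]mulrC cc' // mul1r.
under eq_bigr => x _ do rewrite mulrAC h mulr_suml.
rewrite exchange_big /=.
have h2 y : \sum_x c y * ach (x * y) * ach x = if y == -1 then c y * p%:R else 0.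
  transitivity (c y * \sum_x ach ((y + 1) * x)).
    rewrite mulr_sumr; apply: eq_bigr => x _.
    by rewrite -mulrA -achD; congr (_ * ach _); ring.
  by rewrite sum_ach addr_eq0; case: eqP => // _; rewrite mulr0.
under eq_bigr => y _ do rewrite h2.
by rewrite -big_mkcond big_pred1_eq.
Qed.

(** The terms with [x + y = t] add up to [c t * c' t] times the Jacobi sum:
    rescale by [t] if [t != 0]; if [t = 0] both sides vanish, because [c * c']
    is nontrivial. *)
Lemma gauss_mul c c' : mulchar c -> mulchar c' ->
  nontrivial (fun y => c y * c' y) ->
  gauss c * gauss c' = jacobi c c' * gauss (fun y => c y * c' y).
Proof.
move=> hc hc' ncc'.
have [c0 c1 cM] := hc; have [c0' c1' cM'] := hc'.
have hcc' : mulchar (fun y => c y * c' y).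
  split; rewrite ?c0 ?mul0r ?c1 ?c1' ?mulr1 // => x y.
  by rewrite cM cM' mulrACA.
have h t : \sum_x c x * c' (t - x) = c t * c' t * jacobi c c'.
  case: (eqVneq t 0) => [->|t0].
    transitivity (c' (-1) * \sum_x c x * c' x); last first.
      by rewrite (mulchar_sum hcc' ncc') c0 !mul0r mulr0.
    rewrite mulr_sumr.
    by apply: eq_bigr => x _; rewrite sub0r -(mulN1r x) cM' mulrCA.
  rewrite (reindex_inj (mulfI t0)) mulr_sumr; apply: eq_bigr => x _.
  by rewrite -{2}[t]mulr1 -mulrBr cM cM' mulrACA.
rewrite /gauss mulr_suml mulr_sumr.
transitivity (\sum_x \sum_t c x * c' (t - x) * ach t).
  apply: eq_bigr => x _; rewrite mulr_sumr [RHS](reindex_inj (addIr x)).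
  apply: eq_bigr => y _; rewrite addrK [y + x]addrC achD; ring.
rewrite exchange_big /=; apply: eq_bigr => t _.
by rewrite -mulr_suml h; ring.
Qed.

End GaussSums.

(** A root of [1 + X + ... + X ^ (p - 1)], which is not 1 as [p] is nonzero. *)
Lemma exists_unity_root (K : closedFieldType) (p : nat) :
  prime p -> (p%:R : K) != 0 -> exists2 z : K, z ^+ p = 1 & z != 1.
Proof.
move=> pp p0; have p1 := prime_gt1 pp.
have hs : size (\poly_(i < p) (1 : K)) == p.
  by rewrite size_poly_eq ?oner_eq0.
have /closed_rootP[z] : size (\poly_(i < p) (1 : K)) != 1%N.
  by rewrite (eqP hs); case: (p) p1 => [|[]].
rewrite rootE horner_poly => /eqP h; exists z.
  apply/eqP; rewrite -subr_eq0 subrX1.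
  have -> : \sum_(i < p) z ^+ i = 0.
    by rewrite -[RHS]h; apply: eq_bigr => i _; rewrite mul1r.
  by rewrite mulr0.
apply: contraNneq p0 => z1; rewrite -h z1.
under eq_bigr => i _ do rewrite expr1n mulr1.
by rewrite sumr_const card_ord.
Qed.

(** * The quartic character *)

Lemma Fp_nat_eq0 (p n : nat) : prime p -> ((n%:R : 'F_p) == 0) = (p %| n)%N.
Proof. by move=> pp; rewrite -(dvdn_pcharf (pchar_Fp pp)). Qed.

Lemma Fp_int_eq0 (p : nat) (n : int) :
  prime p -> ((n%:~R : 'F_p) == 0) = (p%:Z %| n)%Z.
Proof. by move=> pp; rewrite -(dvdz_pcharf (pchar_Fp pp)). Qed.

Definition re4 (k : nat) : int :=
  if (k %% 4 == 0)%N then 1 else if (k %% 4 == 2)%N then -1 else 0.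
Definition im4 (k : nat) : int :=
  if (k %% 4 == 1)%N then 1 else if (k %% 4 == 3)%N then -1 else 0.

Lemma expi_re_im (K : comPzRingType) (i : K) (hi : i ^+ 2 = -1) (k : nat) :
  i ^+ k = (re4 k)%:~R + (im4 k)%:~R * i.
Proof.
have hii : i * i = -1 by rewrite -expr2.
rewrite -(expi_mod4 hi) /re4 /im4.
have : (k %% 4 < 4)%N by rewrite ltn_mod.
case: (k %% 4)%N => [|[|[|[|]]]] //= _; rewrite ?exprS ?expr0 ?mulr1 ?hii; ring.
Qed.

Section Quartic.
Variables (p : nat) (f : 'F_p).
Hypotheses (p_pr : prime p) (p1 : (p %% 4 = 1)%N) (hf : f ^+ 2 = -1).
Let m := (p %/ 4)%N.

Let pE : p = (4 * m).+1.
Proof. by rewrite /m {1}(divn_eq p 4) p1 addn1 mulnC. Qed.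

Let m_gt0 : (0 < m)%N.
Proof. have := prime_gt1 p_pr; rewrite pE; case: m => //. Qed.

Lemma Fp_two_neq0 : (2 : 'F_p) != 0.
Proof.
rewrite Fp_nat_eq0 //; apply/negP => /dvdn_leq h.
by have := h isT; have := prime_gt1 p_pr; lia.
Qed.
Let h2 := Fp_two_neq0.

Lemma Fp_fermat (y : 'F_p) : y != 0 -> y ^+ (4 * m) = 1.
Proof.
move=> y0; apply: (mulfI y0); rewrite mulr1 -exprS -pE.
by have := expf_card y; rewrite card_Fp.
Qed.

Lemma Fp_primitive_root : exists g : 'F_p, (4 * m).-primitive_root g.
Proof.
have : has (4 * m).-primitive_root (enum (predC1 (0 : 'F_p))).
  apply: has_prim_root; first by rewrite muln_gt0.
  - by apply/allP => y; rewrite mem_enum /= => h; apply/unity_rootP/Fp_fermat.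
  - exact: enum_uniq.
  - rewrite -cardE.
    have := cardC1 (0 : 'F_p); rewrite card_Fp // pE /= => h.
    by rewrite -{1}h.
by case/hasP => g _ hg; exists g.
Qed.

(** Euler's criterion: [v] is an even power of a primitive root. *)
Lemma Fp_square (v : 'F_p) : v != 0 -> v ^+ (2 * m) = 1 -> exists z, z ^+ 2 = v.
Proof.
move=> v0 hv; have [g hg] := Fp_primitive_root.
have [k hk] := prim_rootP hg (Fp_fermat v0).
move: hv; rewrite hk -exprM => /eqP; rewrite -(prim_order_dvd hg).
have -> : (4 * m %| k * (2 * m))%N = (2 %| k)%N.
  by rewrite -[in RHS](@dvdn_pmul2r (2 * m)) ?muln_gt0 ?m_gt0 //; congr (_ %| _)%N; lia.
by case/dvdnP=> j ->; exists (g ^+ j); rewrite -exprM.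
Qed.

(** The quartic residue character modulo [p] with values in an arbitrary field:
    the root of unity [f] of ['F_p] is replaced by [i].  Taking [K] equal to
    ['F_p], to the algebraic numbers, and to a field of characteristic [q] gives
    three views of the same Gauss and Jacobi sums. *)
Definition chi (K : fieldType) (i : K) (y : 'F_p) : K :=
  if y == 0 then 0 else i ^+ qlog f (y ^+ m).

Lemma f_qlog (y : 'F_p) : y != 0 -> f ^+ qlog f (y ^+ m) = y ^+ m.
Proof. by move=> y0; apply: qlogK => //; rewrite -exprM mulnC Fp_fermat. Qed.

Lemma chi_self (y : 'F_p) : chi f y = y ^+ m.
Proof.
rewrite /chi; case: eqP => [->|/eqP y0]; last exact: f_qlog.
by rewrite expr0n; case: m m_gt0.
Qed.

Section CharK.
Variables (K : fieldType) (i : K).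
Hypotheses (hi : i ^+ 2 = -1).
Notation ch := (chi i).

(** Relations between powers of residues transfer to the values of [chi]. *)
Lemma chi_expi (y : 'F_p) (k : nat) : y ^+ m = f ^+ k -> ch y = i ^+ k.
Proof.
move=> hy; have y0 : y != 0.
  apply: contra_eq_neq hy => ->; rewrite expr0n eq_sym.
  by case: m m_gt0 => //= *; rewrite expi_neq0.
rewrite /chi (negbTE y0) -(expi_mod4 hi) hy.
by rewrite (qlog_expi hf h2) expi_mod4.
Qed.

Lemma chi_mulchar : mulchar ch.
Proof.
split; rewrite ?/chi ?eqxx //.
  by rewrite oner_eq0 expr1n /qlog eqxx.
move=> x y; case: (eqVneq x 0) => [->|x0]; first by rewrite !(mul0r, eqxx) /= ?mul0r.
case: (eqVneq y 0) => [->|y0]; first by rewrite !(mulr0, eqxx) /= ?mulr0.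
have xy0 : x * y != 0 by rewrite mulf_neq0.
rewrite (negbTE xy0) -exprD -[LHS](expi_mod4 hi) -[RHS](expi_mod4 hi).
congr (_ ^+ _); apply/(expi_inj hf h2).
by rewrite exprD !f_qlog // exprMn.
Qed.

Lemma chi0 : ch 0 = 0. Proof. by case: chi_mulchar. Qed.
Lemma chi1 : ch 1 = 1. Proof. by case: chi_mulchar. Qed.
Lemma chiM x y : ch (x * y) = ch x * ch y. Proof. by case: chi_mulchar. Qed.
Lemma chiX x n : ch (x ^+ n) = ch x ^+ n.
Proof. by elim: n => [|n IH]; rewrite ?expr0 ?chi1 // !exprS chiM IH. Qed.
Lemma chi4 y : y != 0 -> ch y ^+ 4 = 1.
Proof.
move=> y0; rewrite -chiX; rewrite (@chi_expi _ 0) // -exprM Fp_fermat //.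
Qed.
Lemma chi_sqrN1 : ch (-1) ^+ 2 = 1.
Proof. by rewrite -chiX sqrrN expr1n chi1. Qed.

Lemma chi_sq_sq y : y != 0 -> ch (y ^+ 2) ^+ 2 = 1.
Proof. by move=> y0; rewrite -chiX -exprM chiX chi4. Qed.

Lemma chi_gen : exists2 t, t != 0 & ch t ^+ 2 = -1.
Proof.
have [g hg] := Fp_primitive_root.
have g0 : g != 0.
  apply: contra_eq_neq (prim_expr_order hg) => ->; rewrite expr0n eq_sym.
  by case: m m_gt0 => //= *; rewrite oner_eq0.
exists g => //; rewrite -chiX -hi; apply: chi_expi; rewrite -exprM hf.
have : (g ^+ (2 * m)) ^+ 2 == 1.
  by rewrite -exprM (_ : _ * 2 = 4 * m)%N ?Fp_fermat //; lia.
rewrite sqrf_eq1 => /orP[|/eqP//]; rewrite -(prim_order_dvd hg).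
by move/dvdn_leq; rewrite muln_gt0 m_gt0 => /(_ isT); lia.
Qed.

Hypothesis (h2K : (2 : K) != 0).
Let hN1 : (-1 : K) != 1.
Proof.
by apply: contraNneq h2K => h; rewrite -[2]/(1 + 1 : K) -{1}h addNr eqxx.
Qed.

Lemma chi_nontrivial : nontrivial ch.
Proof.
have [t t0 ht] := chi_gen; exists t => //.
by apply: contraNneq hN1 => h; rewrite -ht h expr1n.
Qed.

Lemma rho_nontrivial : nontrivial (fun y => ch y * ch y).
Proof. by have [t t0 ht] := chi_gen; exists t; rewrite // -expr2 ht. Qed.

Lemma rho_mulchar : mulchar (fun y => ch y * ch y).
Proof.
split; rewrite ?chi0 ?mul0r ?chi1 ?mulr1 // => x y.
by rewrite chiM mulrACA.
Qed.

(** [chi ^ 2] is the quadratic character. *)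
Lemma card_sqrt v : #|[pred y : 'F_p | y ^+ 2 == v]|%:R = 1 + ch v ^+ 2.
Proof.
case: (eqVneq v 0) => [->|v0].
  rewrite chi0 expr0n addr0 (fintype.eq_card1 (x := 0)) // => y.
  by rewrite !inE sqrf_eq0.
case: (pickP [pred y : 'F_p | y ^+ 2 == v]) => [y /= /eqP hy | hn].
  have y0 : y != 0 by apply: contra_neq v0 => y0; rewrite -hy y0 expr0n.
  have -> : #|[pred y : 'F_p | y ^+ 2 == v]| = 2%N.
    have yNy : y != - y.
      rewrite -subr_eq0 opprK -mulr2n -mulr_natl mulf_neq0 //.
    transitivity #|pred2 y (- y)|; last by rewrite card2 yNy.
    by apply: eq_card => w; rewrite !inE -hy eqf_sqr.
  by rewrite -hy chi_sq_sq.
rewrite (fintype.eq_card0 hn) -chiX (@chi_expi _ 2) ?hi ?subrr // -exprM hf.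
have : (v ^+ (2 * m)) ^+ 2 == 1.
  by rewrite -exprM (_ : _ * 2 = 4 * m)%N ?Fp_fermat //; lia.
rewrite sqrf_eq1 => /orP[/eqP/(Fp_square v0)[w hw]|/eqP//].
by have := hn w; rewrite /= hw eqxx.
Qed.

Lemma sum_squares (G : 'F_p -> K) :
  \sum_y G (y ^+ 2) = \sum_v (1 + ch v ^+ 2) * G v.
Proof.
rewrite (partition_big (fun y => y ^+ 2) predT) //=; apply: eq_bigr => v _.
rewrite -card_sqrt (eq_bigr (fun _ => G v)); last by move=> y /eqP->.
by rewrite sumr_const mulr_natl.
Qed.

(** Thus [chi 4 = chi (-1)], which removes the quadratic character of 2 from
    the comparison of Jacobi sums. *)
Lemma chi_m4 : ch (-4) = 1.
Proof.
have -> : (-4 : 'F_p) = (1 + f) ^+ 4.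
  transitivity (((1 + f) ^+ 2) ^+ 2); last by rewrite -exprM.
  have -> : (1 + f) ^+ 2 = 2 * f.
    by rewrite sqrrD hf expr1n; ring.
  rewrite exprMn hf; ring.
rewrite chiX chi4 // addrC addr_eq0; apply: contraNneq h2 => h.
move: hf; rewrite h sqrrN expr1n => h'.
by rewrite -[2]/(1 + 1 : 'F_p) {1}h' addNr eqxx.
Qed.

(** Completing the square: [y (1 - y) = (1 - (2 y - 1) ^ 2) / 4]. *)
Lemma jacobi_chi_rho :
  jacobi ch (fun y => ch y * ch y) = ch (-1) * jacobi ch ch.
Proof.
have -> : jacobi ch ch = ch (-1) * \sum_y ch (1 - y ^+ 2).
  rewrite mulr_sumr /jacobi.
  have inj : injective (fun y : 'F_p => (1 + y) / 2).
    by move=> y w /(mulIf (invr_neq0 h2)) /addrI.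
  rewrite (reindex_inj inj); apply: eq_bigr => y _; rewrite -!chiM.
  rewrite -[LHS]mul1r -chi_m4 -chiM; congr (ch _).
  field; exact: h2.
rewrite mulrA -expr2 chi_sqrN1 mul1r.
rewrite (sum_squares (fun v => ch (1 - v))).
under [RHS]eq_bigr => v _ do rewrite mulrDl mul1r.
rewrite big_split /=.
have -> : \sum_i ch (1 - i) = 0.
  rewrite -[RHS](mulchar_sum chi_mulchar chi_nontrivial) [RHS](reindex_inj (subrI 1)) //.
rewrite add0r /jacobi (reindex_inj (subrI 1)); apply: eq_bigr => y _.
by rewrite subKr -expr2 mulrC.
Qed.

End CharK.
End Quartic.

Lemma oppi_sq (K : fieldType) (i : K) (hi : i ^+ 2 = -1) : (- i) ^+ 2 = -1.
Proof. by rewrite sqrrN. Qed.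

Lemma oppi_expi (K : fieldType) (i : K) (hi : i ^+ 2 = -1) k :
  (- i) ^+ k = i ^+ (3 * k).
Proof. by rewrite exprM exprS hi mulrN1. Qed.

Section JacobiSum.
Variables (p : nat) (f : 'F_p).
Hypotheses (p_pr : prime p) (p1 : (p %% 4 = 1)%N) (hf : f ^+ 2 = -1).
Let m := (p %/ 4)%N.
Let pE : p = (4 * m).+1.
Proof. by rewrite /m {1}(divn_eq p 4) p1 addn1 mulnC. Qed.
Let m_gt0 : (0 < m)%N.
Proof. have := prime_gt1 p_pr; rewrite pE; case: m => //. Qed.
Let h2 : (2 : 'F_p) != 0 := Fp_two_neq0 p_pr p1.

Lemma chi_conj (K : fieldType) (i : K) (hi : i ^+ 2 = -1) y :
  chi f (- i) y = chi f i y ^+ 3.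
Proof.
rewrite /chi; case: eqP => _; first by rewrite expr0n.
by rewrite oppi_expi // mulnC exprM.
Qed.

Lemma chi_cube_inv (K : fieldType) (i : K) (hi : i ^+ 2 = -1) y :
  y != 0 -> chi f i y * chi f (- i) y = 1.
Proof. by move=> y0; rewrite chi_conj // -exprS chi4. Qed.

(** * Fourth power of the quartic Gauss sum *)

Section CharK.
Variables (K : fieldType) (i z : K).
Hypotheses (hi : i ^+ 2 = -1) (h2K : (2 : K) != 0).
Hypotheses (zp : z ^+ p = 1) (z1 : z != 1).

Lemma gauss_rho_sq : gauss z (fun y => chi f i y * chi f i y) ^+ 2 = p%:R.
Proof.
have hr := rho_mulchar p_pr p1 hf hi.
rewrite expr2 (gauss_mul_inv p_pr zp z1 hr hr) ?mul1r.
- by rewrite -expr2 chi_sqrN1 // mul1r.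
- exact: rho_nontrivial.
- by move=> y y0; rewrite -(chi4 p_pr p1 hf hi y0); ring.
Qed.

Lemma gauss_chi_sq :
  gauss z (chi f i) ^+ 2 =
  jacobi (chi f i) (chi f i) * gauss z (fun y => chi f i y * chi f i y).
Proof.
have hc := chi_mulchar p_pr p1 hf hi.
by rewrite expr2 (gauss_mul p_pr zp) //; apply: rho_nontrivial.
Qed.

Lemma gauss_chi_four :
  gauss z (chi f i) ^+ 4 = jacobi (chi f i) (chi f i) ^+ 2 * p%:R.
Proof. by rewrite -[4%N]/(2 * 2)%N exprM gauss_chi_sq exprMn gauss_rho_sq. Qed.

Lemma gauss_chi_conj :
  gauss z (chi f i) * gauss z (chi f (- i)) = chi f i (-1) * p%:R.
Proof.
apply: (gauss_mul_inv p_pr zp z1).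
- exact: chi_mulchar.
- by apply: chi_mulchar; rewrite ?oppi_sq.
- exact: chi_nontrivial.
- by move=> y; apply: chi_cube_inv.
Qed.

(** Compare [gauss chi ^ 2] and the conjugate square with the product of the
    two Gauss sums; both squares involve the same quadratic Gauss sum. *)
Lemma jacobi_norm : (p%:R : K) != 0 ->
  jacobi (chi f i) (chi f i) * jacobi (chi f (- i)) (chi f (- i)) = p%:R.
Proof.
move=> p0.
have hi' := oppi_sq hi.
have hc := chi_mulchar p_pr p1 hf hi.
have hc' := chi_mulchar p_pr p1 hf hi'.
have e1 := gauss_chi_sq.
have e2 : gauss z (chi f (- i)) ^+ 2 = jacobi (chi f (- i)) (chi f (- i))
            * gauss z (fun y => chi f i y * chi f i y).
  rewrite expr2 (gauss_mul p_pr zp) //; last by apply: rho_nontrivial.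
  congr (_ * _); apply: eq_bigr => y _; congr (_ * _).
  case: (eqVneq y 0) => [->|y0]; first by rewrite /chi eqxx !mul0r.
  rewrite chi_conj // -exprD -[(3 + 3)%N]/(4 + 2)%N exprD chi4 // mul1r //.
have := congr1 (fun t => t ^+ 2) gauss_chi_conj.
rewrite exprMn e1 e2 mulrACA -expr2 gauss_rho_sq exprMn chi_sqrN1 // mul1r expr2.
by move/(mulIf p0).
Qed.

End CharK.

(** * The Jacobi sum as a Gaussian integer *)

(** [jacA + jacB i] is the Jacobi sum [J(chi, chi)].  As sums of exponents the
    two integers do not depend on the field in which the sum is evaluated. *)
Definition jexp (y : 'F_p) : nat := qlog f (y ^+ m) + qlog f ((1 - y) ^+ m).
Definition jacA : int := \sum_(y | (y != 0) && (y != 1)) re4 (jexp y).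
Definition jacB : int := \sum_(y | (y != 0) && (y != 1)) im4 (jexp y).

Lemma jacobi_AB (K : fieldType) (i : K) : i ^+ 2 = -1 ->
  jacobi (chi f i) (chi f i) = jacA%:~R + jacB%:~R * i.
Proof.
move=> hi; rewrite /jacA /jacB !rmorph_sum /= mulr_suml -big_split /=.
rewrite /jacobi (bigID (fun y => (y != 0) && (y != 1))) /= addrC big1 ?add0r.
  apply: eq_bigr => y /andP[y0 y1].
  rewrite -expi_re_im // /chi (negbTE y0) subr_eq0 eq_sym (negbTE y1).
  by rewrite -exprD.
move=> y; rewrite negb_and !negbK => /orP[/eqP->|/eqP->].
  by rewrite /chi eqxx mul0r.
by rewrite subrr {2}/chi eqxx mulr0.
Qed.

(** The norm identity, read in characteristic 0. *)
Lemma jacA_jacB_norm : jacA ^+ 2 + jacB ^+ 2 = p%:Z.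
Proof.
have p0 : (p%:R : algC) != 0 by rewrite pnatr_eq0 pE.
have [z zp z1] := exists_unity_root p_pr p0.
have h2C : (2 : algC) != 0 by rewrite pnatr_eq0.
have := jacobi_norm (sqrCi _) h2C zp z1 p0.
rewrite !jacobi_AB ?sqrrN ?sqrCi // => h.
apply/eqP; rewrite -(eqr_int algC) -[p%:~R]h rmorphD !rmorphXn /=; apply/eqP.
have -> (a b : algC) : (a + b * 'i) * (a + b * - 'i) = a ^+ 2 - b ^+ 2 * ('i ^+ 2).
  by ring.
by rewrite sqrCi mulrN1 opprK.
Qed.

Lemma sum_pow_Fp (k : nat) : (k < p.-1)%N -> \sum_(y : 'F_p) y ^+ k = 0.
Proof.
case: (posnP k) => [->|k0] hk.
  under eq_bigr => y _ do rewrite expr0.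
  by rewrite sumr_const card_Fp //; apply/eqP; rewrite Fp_nat_eq0.
have [g hg] := Fp_primitive_root p_pr p1.
apply: (@mulchar_sum p 'F_p (fun y => y ^+ k)).
  by split=> [|| x y]; rewrite ?expr0n ?expr1n ?exprMn //; case: k k0 hk.
exists g.
  apply: contra_eq_neq (prim_expr_order hg) => ->; rewrite expr0n eq_sym.
  by rewrite -/m; case: m m_gt0 => //= *; rewrite oner_eq0.
rewrite -(prim_order_dvd hg); apply/negP => /(dvdn_leq k0).
by move: hk; rewrite {1}pE /= -/m; lia.
Qed.

(** In ['F_p] itself the Jacobi sum is the sum of all values of a polynomial of
    degree less than [p - 1]. *)
Lemma jacobi_vanish : jacA%:~R + jacB%:~R * f = 0.
Proof.
rewrite -jacobi_AB // /jacobi.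
pose P : {poly 'F_p} := 'X ^+ m * (1 - 'X) ^+ m.
have sP : (size P <= p.-1)%N.
  apply: leq_trans (size_polyMleq _ _) _; rewrite size_polyXn.
  apply: (@leq_trans (m.+1 + m.+1).-1).
    rewrite -!subn1 leq_sub2r // leq_add2l.
    apply: leq_trans (size_poly_exp_leq _ _) _; rewrite ltnS.
    have -> : size (1 - 'X : {poly 'F_p}) = 2%N.
      by rewrite -opprB size_polyN size_XsubC.
    by rewrite mul1n.
  by have := pE; have := m_gt0; lia.
transitivity (\sum_(y : 'F_p) P.[y]).
  by apply: eq_bigr => y _; rewrite !chi_self // !hornerE.
under eq_bigr => y _ do rewrite (horner_coef_wide _ sP).
rewrite exchange_big /= big1 // => k _.
by rewrite -mulr_sumr sum_pow_Fp ?mulr0.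
Qed.

(** The involution [y -> 1 - y] pairs off the summands of the Jacobi sum,
    except the one at [1/2].  The order of representatives selects one element
    of each pair. *)
Definition lower (y : 'F_p) : bool := (y < (1 - y)%R)%N.
Definition lower_half := [set y : 'F_p | (y != 0) && (y != 1) && lower y].

Lemma half_fix : 1 - 2^-1 = 2^-1 :> 'F_p.
Proof. by field; exact: h2. Qed.

Lemma lower_sym y : y != 2^-1 -> lower (1 - y) = ~~ lower y.
Proof.
move=> hy; rewrite /lower subKr -leqNgt [RHS]leq_eqVlt; case: eqP => // h.
have e : 1 - y = y by apply: val_inj.
case/eqP: hy; apply: (mulIf h2); rewrite mulVf // mulrDr mulr1 -{1}e subrK //.
Qed.

Lemma sum_pairs (h : 'F_p -> int) : (forall y, h (1 - y) = h y) ->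
  \sum_(y | (y != 0) && (y != 1)) h y = 2 * \sum_(y in lower_half) h y + h 2^-1.
Proof.
move=> hsym.
have half0 : (2^-1 : 'F_p) != 0 by rewrite invr_eq0.
have half1 : (2^-1 : 'F_p) != 1.
  by apply: contra_neq half0 => hq; rewrite -half_fix hq subrr.
have lowhalf : lower 2^-1 = false by rewrite /lower half_fix ltnn.
rewrite (bigID lower) /=.
rewrite [X in _ + X](bigD1 2^-1) /=; last by rewrite half0 half1 lowhalf.
rewrite [X in _ + X]addrC addrA; congr (_ + _).
rewrite -[2]/(1 + 1) mulrDl !mul1r; congr (_ + _).
  by apply: eq_bigl => y; rewrite inE.
rewrite (reindex_inj (subrI 1)) /=; apply: eq_big => y; last by rewrite hsym.
have e a b : (1 - a == b :> 'F_p) = (a == 1 - b).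
  by apply/eqP/eqP => [<-|->]; rewrite subKr.
rewrite inE !e subrr subr0 half_fix [(y != 1) && _]andbC -!andbA.
do 2! congr (_ && _).
case: eqP => [->|/eqP hy]; first by rewrite lowhalf andbF.
by rewrite andbT lower_sym // negbK.
Qed.

End JacobiSum.

Lemma re4_im4_odd k : exists c : int, re4 k + im4 k = 1 + 2 * c.
Proof.
rewrite /re4 /im4; have : (k %% 4 < 4)%N by rewrite ltn_mod.
case: (k %% 4)%N => [|[|[|[|]]]] //= _; by [exists 0 | exists (-1)].
Qed.

Lemma re4_double k : re4 (2 * k) = (-1) ^+ k.
Proof.
rewrite -signr_odd /re4.
have -> : (2 * k %% 4 = 2 * odd k)%N by lia.
by case: (odd k).
Qed.

Lemma im4_double k : im4 (2 * k) = 0.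
Proof.
rewrite /im4.
have -> : (2 * k %% 4 = 2 * odd k)%N by lia.
by case: (odd k).
Qed.

Lemma int_parity (s : int) : exists q : int, s = 2 * q \/ s = 2 * q + 1.
Proof. by exists (s %/ 2)%Z; lia. Qed.

Lemma sqr_mod2 (s : int) : exists t : int, s ^+ 2 = s + 2 * t.
Proof.
have [q [->|->]] := int_parity s; [exists (2 * q ^+ 2 - q)| exists (2 * q ^+ 2 + q)];
  ring.
Qed.

Section JacobiValue.
Variables (p : nat) (f : 'F_p).
Hypotheses (p_pr : prime p) (p1 : (p %% 4 = 1)%N) (hf : f ^+ 2 = -1).
Let m := (p %/ 4)%N.
Let pE : p = (4 * m).+1.
Proof. by rewrite /m {1}(divn_eq p 4) p1 addn1 mulnC. Qed.
Let h2 : (2 : 'F_p) != 0 := Fp_two_neq0 p_pr p1.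

Lemma jexp_sym (y : 'F_p) : jexp f (1 - y) = jexp f y.
Proof. by rewrite /jexp subKr addnC. Qed.

(** [chi (1/2) ^ 2 = chi 4 = chi (-1) = (-1) ^ m], because [-4] is a fourth
    power. *)
Lemma jexp_half : exists2 k, jexp f 2^-1 = (2 * k)%N & odd k = odd m.
Proof.
exists (qlog f (2^-1 ^+ m)).
  by rewrite /jexp half_fix // addnn mul2n.
set k := qlog _ _.
have e : f ^+ (2 * k) = f ^+ (2 * m).
  rewrite mulnC exprM f_qlog ?invr_eq0 // exprM hf -exprM mulnC exprM exprVn.
  apply: (mulIf (_ : 4 ^+ m != 0 :> 'F_p)).
    by rewrite expf_neq0 // -[4]/(2 * 2)%:R natrM mulf_neq0.
  rewrite -exprMn -[X in (_ * X) ^+ _]/(2 * 2)%:R natrM -expr2 mulVf ?expf_neq0 //.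
  rewrite expr1n -exprMn mulN1r.
  have := chi_m4 p_pr p1 hf hf; rewrite chi_self // => h; rewrite -[LHS]h; congr (_ ^+ _); ring.
by move/(expi_inj hf h2): e; lia.
Qed.

Lemma card_lower_half : (2 * #|lower_half p| + 3 = p)%N.
Proof.
have := sum_pairs p_pr p1 (h := fun=> 1) (fun=> erefl).
rewrite !sumr_const => h.
have c : (#|[pred y : 'F_p | (y != 0%R) && (y != 1%R)]| + 2 = p)%N.
  rewrite -[RHS](card_Fp p_pr) -(cardC (pred2 (0 : 'F_p) 1)) card2.
  rewrite eq_sym oner_eq0 addnC; congr (_ + _)%N; apply: eq_card => y.
  by rewrite !inE negb_or.
have {}h : #|[pred y : 'F_p | (y != 0%R) && (y != 1%R)]|%:R
    = 2 * #|lower_half p|%:R + 1 :> int := h.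
by rewrite !natz in h; move: c h; move: #|_| #|_| => a b; lia.
Qed.

(** The diagonal term decides the class of [jacA]: the rest of the sum is twice
    a sum of an odd number of units.  The norm identity modulo 8 then relates
    the parity of [jacB / 2] to that of [m]. *)
Lemma jacA_jacB_mod : exists c : int, exists b : int,
  jacA f = 4 * c - 1 /\ jacB f = 2 * b.
Proof.
have [k hk om] := jexp_half.
have hA := sum_pairs p_pr p1 (h := fun y => re4 (jexp f y)).
have hB := sum_pairs p_pr p1 (h := fun y => im4 (jexp f y)).
rewrite -/(jacA f) in hA; rewrite -/(jacB f) in hB.
have {}hA := hA (fun y => congr1 re4 (jexp_sym y)).
have {}hB := hB (fun y => congr1 im4 (jexp_sym y)).
rewrite hk re4_double in hA; rewrite hk im4_double addr0 in hB.
have [s hs] : exists s, \sum_(y in lower_half p) (re4 (jexp f y) + im4 (jexp f y))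
     = #|lower_half p|%:Z + 2 * s.
  exists (\sum_(y in lower_half p) ((re4 (jexp f y) + im4 (jexp f y) - 1) %/ 2)%Z).
  rewrite mulr_sumr -sum1_card -natz natr_sum -big_split /=; apply: eq_bigr => y _.
  have [c ->] := re4_im4_odd (jexp f y); lia.
rewrite big_split /= in hs.
have := jacA_jacB_norm p_pr p1 hf; have := card_lower_half.
set A := jacA f in hA *; set B := jacB f in hB *.
set SA := \sum_(y in _) re4 _ in hA hs; set SB := \sum_(y in _) im4 _ in hB hs.
move: #|_| hs => n hs hn hAB.
rewrite -signr_odd om in hA.
have hm : p%:Z = 4 * m%:Z + 1 by rewrite {1}pE; lia.
have hB2 : B = 2 * SB by [].
have hj : p%:Z = 2 * n%:Z + 3 by move: hn; clear; lia.
have mo : m%:Z = (nat_of_bool (odd m))%:Z + 2 * (m./2)%:Z by lia.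
have [t ht] := sqr_mod2 SB.
have [u hu] : exists u, (A ^+ 2 = 1 + 8 * u).
  have [v hv] : exists v, A = 2 * v + 1.
    by case: (odd m) hA => /=; [exists (SA - 1) | exists SA]; clear -hA; lia.
  have [w hw] := sqr_mod2 v; exists (v + w); rewrite hv sqrrD exprMn hw; ring.
have hSB : m%:Z = SB + 2 * (t + u).
  by move: hAB hm; rewrite hu hB2 exprMn ht; clear; lia.
exists ((A + 1) %/ 4)%Z; exists SB; split => //.
by case: (odd m) hA mo => /= hA mo; clear -hA mo hs hj hm hSB hB2; lia.
Qed.

End JacobiValue.

Lemma re4_im4_mul3 k : re4 (k * 3) = re4 k /\ im4 (k * 3) = - im4 k.
Proof.
rewrite /re4 /im4 -(modnMml k 3 4); have : (k %% 4 < 4)%N by rewrite ltn_mod.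
by case: (k %% 4)%N => [|[|[|[|]]]].
Qed.

Section TwoSquares.
Variables (p : nat) (a x : int).
Hypotheses (p_pr : prime p) (hp : p%:Z = a ^+ 2 + x ^+ 2).
Hypotheses (ha : (a = 1 %[mod 4])%Z) (hx : (2 %| x)%Z).
Let m := (p %/ 4)%N.

Lemma two_squares_coord : exists k w : int, a = 4 * k + 1 /\ x = 2 * w.
Proof. exists (a %/ 4)%Z, (x %/ 2)%Z; lia. Qed.

Lemma two_squares_mod4 : (p %% 4 = 1)%N.
Proof.
have [k [w [hk hw]]] := two_squares_coord.
have : p%:Z = 4 * (k * (4 * k + 2) + w ^+ 2) + 1 by rewrite hp hk hw; ring.
by move: (_ + w ^+ 2) => t; lia.
Qed.

Lemma Fp_alpha_neq0 : (a%:~R : 'F_p) != 0.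
Proof.
have [k [w [hk hw]]] := two_squares_coord.
rewrite Fp_int_eq0 //; apply/negP => /dvdzP[c hc].
have a0 : a != 0 by lia.
have c0 : c != 0 by apply: contra_neq a0 => c0; rewrite hc c0 mul0r.
have h1 : 1 <= `|c| by lia.
have p1 : p%:Z >= 2 by have := prime_gt1 p_pr; lia.
have h2 : p%:Z <= `|a|.
  by rewrite hc normrM [`|p%:Z|]ger0_norm // ler_peMl.
have : p%:Z * 2 <= `|a| * `|a| by rewrite ler_pM //; lia.
rewrite -expr2 real_normK ?num_real // => h3.
by have := sqr_ge0 x; lia.
Qed.

(** The image of [i] under reduction modulo the prime [a + x i] of [Z[i]]. *)
Definition rootN1 : 'F_p := x%:~R / a%:~R.
Notation f := rootN1.

Lemma rootN1_mul : f * a%:~R = x%:~R.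
Proof. by rewrite /f mulfVK // Fp_alpha_neq0. Qed.

Lemma rootN1_sq : f ^+ 2 = -1.
Proof.
have a0 := Fp_alpha_neq0.
apply: (mulIf (expf_neq0 2 a0)); rewrite -exprMn rootN1_mul mulN1r.
apply/eqP; rewrite -addr_eq0 -!rmorphXn -rmorphD /= addrC -hp.
by rewrite Fp_int_eq0 // dvdzz.
Qed.

Let p1 := two_squares_mod4.
Let hf := rootN1_sq.

(** [(jacA, jacB)] and [(a, x)] are two representations of [p] as a sum of two
    squares that are proportional modulo [p].  So they are equal up to sign,
    since parity excludes a rotation by a right angle, and the classes modulo 4
    of [jacA] and [a] give the sign. *)
Lemma jacobi_two_squares : jacA f = - a /\ jacB f = - x.
Proof.
have [k [w [hk hw]]] := two_squares_coord.
have [c [b [hA hB]]] := jacA_jacB_mod p_pr p1 hf.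
have hn := jacA_jacB_norm p_pr p1 hf.
have h0 := jacobi_vanish p_pr p1 hf.
set A := jacA f in hA hn h0 *; set B := jacB f in hB hn h0 *.
have /dvdzP[t ht] : (p%:Z %| A * x - B * a)%Z.
  rewrite -Fp_int_eq0 // rmorphB !rmorphM /= -rootN1_mul.
  have -> : (A%:~R : 'F_p) = - (B%:~R * f) by apply/eqP; rewrite -addr_eq0 h0.
  apply/eqP; transitivity (- (B%:~R * a%:~R) * (f ^+ 2 + 1)); first by ring.
  by rewrite hf addNr mulr0.
have p2 : p%:Z >= 2 by have := prime_gt1 p_pr; lia.
have hsq : (A * x - B * a) ^+ 2 + (A * a + B * x) ^+ 2 = p%:Z ^+ 2.
  transitivity ((A ^+ 2 + B ^+ 2) * (a ^+ 2 + x ^+ 2)); first by ring.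
  by rewrite hn -hp.
have n0 : A * a + B * x != 0.
  apply/eqP; rewrite hA hB hk hw => h.
  have : 2 * (2 * (c * (4 * k + 1)) - 2 * k + 2 * (b * w)) - 1 = 0 by rewrite -h; ring.
  by move: (_ + 2 * (b * w)) => z; clear; lia.
have n1 : 0 < (A * a + B * x) ^+ 2 by rewrite exprn_even_gt0.
have t0 : t = 0.
  apply/eqP; apply/negPn/negP => tn0.
  have h1 : 1 <= t ^+ 2 by have : 0 < t ^+ 2 by [rewrite exprn_even_gt0]; lia.
  have h2 : p%:Z ^+ 2 <= t ^+ 2 * p%:Z ^+ 2 by rewrite ler_peMl // sqr_ge0.
  by have := ltr_pwDr n1 h2; rewrite -exprMn -ht hsq ltxx.
rewrite t0 mul0r in ht.
rewrite ht expr0n add0r in hsq.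
have pn0 : p%:Z != 0 by lia.
have {}ht : A * x = B * a by apply/eqP; rewrite -subr_eq0 ht.
have key : p%:Z * A = a * (A * a + B * x).
  rewrite hp; transitivity (a * (A * a) + x * (A * x)); first by ring.
  by rewrite ht; ring.
have key2 : p%:Z * B = x * (A * a + B * x).
  rewrite hp; transitivity (x * (B * x) + a * (B * a)); first by ring.
  by rewrite -ht; ring.
move/eqP: hsq; rewrite eqf_sqr => /orP[/eqP e|/eqP e]; rewrite e in key key2.
  have : A = a by apply: (mulfI pn0); rewrite key mulrC.
  by move=> eA; move: hA; rewrite eA hk; clear; lia.
split; apply: (mulfI pn0); rewrite ?key ?key2; ring.
Qed.

Lemma jacobi_eq (K : fieldType) (i : K) : i ^+ 2 = -1 ->
  jacobi (chi f i) (chi f i) = - (a%:~R + x%:~R * i).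
Proof.
move=> hi; rewrite jacobi_AB //.
by have [-> ->] := jacobi_two_squares; rewrite !rmorphN /=; ring.
Qed.

(** * Trace of Frobenius *)

(** Substitute [v = - D u] to recognize the Jacobi sum of [chi] and [chi ^ 2]. *)
Lemma sum_chi_rho_shift (K : fieldType) (i : K) (D : 'F_p) :
  i ^+ 2 = -1 -> (2 : K) != 0 -> D != 0 ->
  \sum_v chi f i v * chi f i (v + D) ^+ 2
    = - (chi f i D ^+ 3 * (a%:~R + x%:~R * i)).
Proof.
move=> hi h2 D0.
rewrite -mulrN -(jacobi_eq hi).
have ND0 : - D != 0 by rewrite oppr_eq0.
rewrite (reindex_inj (mulfI ND0)) /=.
transitivity (chi f i (- D) * chi f i D ^+ 2 *
              jacobi (chi f i) (fun y => chi f i y * chi f i y)).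
  rewrite /jacobi mulr_sumr; apply: eq_bigr => v _.
  have -> : - D * v + D = D * (1 - v) by ring.
  rewrite 2!(chiM p_pr p1 hf hi) exprMn.
  by move: (chi f i _) (chi f i _) (chi f i _) (chi f i _); clear; move=> *; ring.
rewrite jacobi_chi_rho // -(mulN1r D) (chiM p_pr p1 hf hi).
have := chi_sqrN1 p_pr p1 hf hi.
move: (chi f i D) (chi f i (-1)) (jacobi _ _) => u v J; clear => v2.
transitivity (v ^+ 2 * (u ^+ 3 * J)); first by ring.
by rewrite v2 mul1r.
Qed.

Lemma card_points (D : int) :
  #|[set xy : 'F_p * 'F_p | xy.2 ^+ 2 == xy.1 ^+ 3 + D%:~R * xy.1]|%:R =
  p%:R + \sum_(y : 'F_p) chi f ('i : algC) (y ^+ 3 + D%:~R * y) ^+ 2.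
Proof.
rewrite -sum1_card natr_sum.
rewrite (eq_bigl (fun xy : 'F_p * 'F_p => xpredT xy.1 &&
           (xy.2 ^+ 2 == xy.1 ^+ 3 + D%:~R * xy.1))); last by move=> xy; rewrite inE.
rewrite -(pair_big_dep xpredT (fun u v : 'F_p => v ^+ 2 == u ^+ 3 + D%:~R * u)
            (fun _ _ => 1%:R)) /=.
transitivity (\sum_(y : 'F_p) (1 + chi f ('i : algC) (y ^+ 3 + D%:~R * y) ^+ 2)).
  apply: eq_bigr => y _; rewrite -(card_sqrt p_pr p1 hf (sqrCi _)) ?pnatr_eq0 //.
  by rewrite -natr_sum sum1_card.
by rewrite big_split /= sumr_const card_Fp.
Qed.

(** Each [x] contributes [rho (x) rho (x ^ 2 + D)], and [rho x = chi (x ^ 2)].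
    So the sum over [x] is a sum over squares, and [1 + rho] turns it into a sum
    over all [v] of [chi v + chi v ^ 3] times [rho (v + D)]. *)
Lemma trace_value (D : int) (k : nat) : (D%:~R : 'F_p) ^+ m = f ^+ k ->
  trace_E D p = 2 * (re4 k * a + im4 k * x).
Proof.
move=> hD.
have D0 : (D%:~R : 'F_p) != 0.
  apply: contra_eq_neq hD => ->; rewrite expr0n eq_sym.
  have m0 : (0 < m)%N.
    by have := prime_gt1 p_pr; have := two_squares_mod4; rewrite /m; lia.
  by case: m m0 => //= *; rewrite expi_neq0 // hf.
have h2C : (2 : algC) != 0 by rewrite pnatr_eq0.
have hi : ('i : algC) ^+ 2 = -1 := sqrCi _.
have hi' := oppi_sq hi.
have e : trace_E D p = p%:Z
    - (#|[set xy : 'F_p * 'F_p | xy.2 ^+ 2 == xy.1 ^+ 3 + D%:~R * xy.1]|)%:Z.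
  by rewrite /trace_E /card_E; lia.
apply/eqP; rewrite e -(eqr_int algC) rmorphB /= [X in _ - X]card_points.
rewrite opprD addNKr; apply/eqP.
pose G (v : 'F_p) := chi f ('i : algC) v * chi f ('i : algC) (v + D%:~R) ^+ 2.
have -> : \sum_(y : 'F_p) chi f ('i : algC) (y ^+ 3 + D%:~R * y) ^+ 2
     = \sum_(y : 'F_p) G (y ^+ 2).
  apply: eq_bigr => y _; rewrite /G.
  have -> : y ^+ 3 + D%:~R * y = y * (y ^+ 2 + D%:~R) by ring.
  by rewrite (chiM p_pr p1 hf hi) exprMn (chiX p_pr p1 hf hi).
rewrite (sum_squares p_pr p1 hf hi h2C).
have -> : \sum_(v : 'F_p) (1 + chi f ('i : algC) v ^+ 2) * G v
  = \sum_v chi f ('i : algC) v * chi f ('i : algC) (v + D%:~R) ^+ 2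
  + \sum_v chi f (- 'i : algC) v * chi f (- 'i : algC) (v + D%:~R) ^+ 2.
  rewrite -big_split /=; apply: eq_bigr => v _; rewrite /G !chi_conj //.
  case: (eqVneq (v + D%:~R) 0) => [->|n0]; first by rewrite /chi eqxx; ring.
  move: (chi f _ (v + _)) (chi f _ v) (chi4 p_pr p1 hf hi n0) => t c h4.
  have -> : (t ^+ 3) ^+ 2 = t ^+ 2.
    by rewrite -exprM -[(3 * 2)%N]/(4 + 2)%N exprD h4 mul1r.
  by ring.
rewrite !sum_chi_rho_shift //.
rewrite (chi_expi p_pr p1 hf hi hD) (chi_expi p_pr p1 hf hi' hD).
rewrite (oppi_expi hi) -!exprM !(expi_re_im hi).
have -> : (3 * k * 3 = k * 3 * 3)%N by lia.
have [-> ->] := re4_im4_mul3 (k * 3); have [-> ->] := re4_im4_mul3 k.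
rewrite opprK.
move: (re4 k) (im4 k) => u v.
transitivity (2 * u%:~R * a%:~R - 2 * v%:~R * x%:~R * 'i ^+ 2 : algC).
  by rewrite rmorphN /=; ring.
by rewrite hi; ring.
Qed.

Lemma trace_eq_2alpha (D : int) (k : nat) : (D%:~R : 'F_p) ^+ m = f ^+ k ->
  (trace_E D p == 2 * a) = (k %% 4 == 0)%N.
Proof.
move=> /trace_value ->.
have [u [w [hk hw]]] := two_squares_coord.
rewrite /re4 /im4; have : (k %% 4 < 4)%N by rewrite ltn_mod.
by case: (k %% 4)%N => [|[|[|[|]]]] //= _; apply/eqP => /=; lia.
Qed.

Lemma trace_eq_N2alpha (D : int) (k : nat) : (D%:~R : 'F_p) ^+ m = f ^+ k ->
  (trace_E D p == 2 * - a) = (k %% 4 == 2)%N.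
Proof.
move=> /trace_value ->.
have [u [w [hk hw]]] := two_squares_coord.
rewrite /re4 /im4; have : (k %% 4 < 4)%N by rewrite ltn_mod.
by case: (k %% 4)%N => [|[|[|[|]]]] //= _; apply/eqP => /=; lia.
Qed.

End TwoSquares.

(** * Quartic reciprocity for rational primes *)

Lemma pchar_odd_two (q : nat) (K : fieldType) :
  prime q -> odd q -> q \in [pchar K] -> (2 : K) != 0.
Proof.
move=> q_pr q_odd hq; rewrite -(dvdn_pcharf hq); apply/negP => /dvdn_leq h.
by have := h isT; have := prime_gt1 q_pr; lia.
Qed.

Section Reciprocity.
Variables (p : nat) (a x : int).
Hypotheses (p_pr : prime p) (hp : p%:Z = a ^+ 2 + x ^+ 2).
Hypotheses (ha : (a = 1 %[mod 4])%Z) (hx : (2 %| x)%Z).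
Notation f := (rootN1 p a x).
Let p1 := two_squares_mod4 p_pr hp ha hx.
Let hf : f ^+ 2 = -1 := rootN1_sq p_pr hp ha hx.

Variables (q : nat).
Hypotheses (q_pr : prime q) (q_odd : odd q) (qp : q != p).

Section CharQ.
Variables (K : fieldType) (i z : K).
Hypotheses (hq : q \in [pchar K]) (hi : i ^+ 2 = -1).
Hypotheses (zp : z ^+ p = 1) (z1 : z != 1).
Let h2 : (2 : K) != 0 := pchar_odd_two q_pr q_odd hq.
Notation ch := (chi f i).
Notation ch' := (chi f (- i)).
Notation pi := (a%:~R + x%:~R * i).
Notation pib := (a%:~R - x%:~R * i).

Lemma charq_p : (p%:R : K) != 0.
Proof. by rewrite -(dvdn_pcharf hq) dvdn_prime2. Qed.

Lemma pi_pib : pi * pib = p%:R.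
Proof.
transitivity (a%:~R ^+ 2 - x%:~R ^+ 2 * i ^+ 2); first by ring.
by rewrite hi mulrN1 opprK -!rmorphXn -rmorphD /= -hp.
Qed.

Lemma pi_neq0 : pi != 0.
Proof. by apply: contraNneq charq_p => h; rewrite -pi_pib h mul0r. Qed.

Lemma pib_neq0 : pib != 0.
Proof. by apply: contraNneq charq_p => h; rewrite -pi_pib h mulr0. Qed.

Lemma pi_frob : pi ^+ q = a%:~R + x%:~R * i ^+ q.
Proof.
rewrite -(pFrobenius_autE hq) rmorphD rmorphM /= !rmorph_int.
by rewrite (pFrobenius_autE hq).
Qed.

Lemma ach_exp (y : 'F_p) n : ach z y ^+ n = ach z (n%:R * y).
Proof.
elim: n => [|n IH]; first by rewrite mul0r.
by rewrite exprSr IH -achD // -[n.+1]addn1 natrD mulrDl mul1r.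
Qed.

(** Frobenius raises the values of the character to the power [q] and moves the
    additive character by the factor [q]. *)
Lemma gauss_frob (c : 'F_p -> K) :
  gauss z c ^+ q = \sum_y c y ^+ q * ach z (q%:R * y).
Proof.
rewrite -(pFrobenius_autE hq) rmorph_sum; apply: eq_bigr => y _ /=.
by rewrite rmorphM /= !(pFrobenius_autE hq) ach_exp.
Qed.

Lemma gauss_chi_pi : gauss z ch ^+ 4 = pi ^+ 3 * pib.
Proof.
rewrite (gauss_chi_four p_pr p1 hf hi h2 zp z1).
by rewrite (jacobi_eq p_pr hp ha hx hi) -pi_pib; ring.
Qed.

Lemma gauss_chi_neq0 : gauss z ch != 0.
Proof.
have : pi ^+ 3 * pib != 0 by rewrite mulf_neq0 ?expf_neq0 ?pi_neq0 ?pib_neq0.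
by rewrite -gauss_chi_pi expf_eq0.
Qed.

Lemma q_neq0 : (q%:R : 'F_p) != 0.
Proof. by rewrite Fp_nat_eq0 // dvdn_prime2 // eq_sym. Qed.

(** For [q = 1 mod 4], Frobenius fixes the values of [chi], so
    [g ^ q = chi(q)^-1 g]; moreover [pi ^ (q - 1) = 1]. *)
Lemma reciprocity1 n : q = (4 * n).+1 -> ch q%:R * pib ^+ n = pi ^+ n.
Proof.
move=> qE.
have hi4 : i ^+ 4 = 1 by rewrite -[4%N]/(2 * 2)%N exprM hi sqrrN expr1n.
have hiq : i ^+ q = i by rewrite qE exprS exprM hi4 expr1n mulr1.
have piq : pi ^+ (4 * n) = 1.
  by apply: (mulfI pi_neq0); rewrite -exprS -qE pi_frob hiq mulr1.
have h : ch q%:R * gauss z ch ^+ q = gauss z ch.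
  rewrite -[RHS](gauss_shift z (chi_mulchar p_pr p1 hf hi) q_neq0) gauss_frob.
  congr (_ * _); apply: eq_bigr => y _; congr (_ * _).
  case: (eqVneq y 0) => [->|y0]; first by rewrite /chi eqxx expr0n qE.
  by rewrite qE exprS exprM chi4 // expr1n mulr1.
have {}h : ch q%:R * (pi ^+ 3 * pib) ^+ n = 1.
  apply: (mulIf gauss_chi_neq0); rewrite mul1r -[RHS]h -gauss_chi_pi -mulrA.
  by rewrite -exprM -exprSr -qE.
apply: (mulIf (expf_neq0 (3 * n) pi_neq0)).
rewrite -exprD (_ : n + 3 * n = 4 * n)%N ?piq; last by lia.
by rewrite -[RHS]h exprMn exprM; ring.
Qed.

(** For [q = 3 mod 4], Frobenius conjugates the values of [chi], so [g ^ q] is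
    a multiple of the conjugate Gauss sum, and [pi ^ q = pib]. *)
Lemma reciprocity3 n : (q.+1 = 4 * n)%N -> ch (- q%:R) * pi ^+ n = pib ^+ n.
Proof.
move=> qE.
have q3 : (q = 4 * n.-1 + 3)%N by lia.
have hi4 : i ^+ 4 = 1 by rewrite -[4%N]/(2 * 2)%N exprM hi sqrrN expr1n.
have hiq : i ^+ q = - i.
  by rewrite q3 exprD exprM hi4 expr1n mul1r exprS hi mulrN1.
have piq : pi ^+ (4 * n) = p%:R.
  by rewrite -qE exprS pi_frob hiq mulrN pi_pib.
have hi' := oppi_sq hi.
have h : ch' q%:R * gauss z ch ^+ q = gauss z ch'.
  rewrite -[RHS](gauss_shift z (chi_mulchar p_pr p1 hf hi') q_neq0) gauss_frob.
  congr (_ * _); apply: eq_bigr => y _; congr (_ * _); rewrite chi_conj //.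
  case: (eqVneq y 0) => [->|y0]; first by rewrite /chi eqxx !expr0n q3 addn3.
  by rewrite q3 exprD exprM chi4 // expr1n mul1r.
have {}h : ch' q%:R * (pi ^+ 3 * pib) ^+ n = ch (-1) * p%:R.
  rewrite -(gauss_chi_conj p_pr p1 hf hi h2 zp z1) -h.
  rewrite -gauss_chi_pi -exprM -qE exprS; ring.
have {}h : ch' q%:R * pib ^+ n = ch (-1) * pi ^+ n.
  apply: (mulIf (expf_neq0 (3 * n) pi_neq0)).
  rewrite -[RHS]mulrA -exprD (_ : n + 3 * n = 4 * n)%N ?piq; last by lia.
  by rewrite -h exprMn exprM; ring.
rewrite -mulN1r chiM // mulrAC -h mulrAC (_ : ch' q%:R * ch q%:R = 1) ?mul1r //.
by rewrite mulrC chi_cube_inv // q_neq0.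
Qed.

End CharQ.
End Reciprocity.

(** * The local symbol *)

(** Signed so as to be 1 modulo 4, which makes reciprocity uniform in [q]. *)
Definition qstar (q : nat) : int := if (q %% 4 == 1)%N then q%:Z else - q%:Z.

Section LocalSymbol.
Variables (q : nat) (a : int) (F : countFieldType) (i : F).
Hypotheses (q_pr : prime q) (q_odd : odd q).
Hypotheses (hq : q \in [pchar F]) (hi : i ^+ 2 = -1).

(** A quarter of the order of the group of [circ_exp]. *)
Definition qord : nat := (q.+1 %/ 4)%N.

(** The quotient or its inverse, according to the two cases of reciprocity. *)
Definition circ (x : int) : F :=
  if (q %% 4 == 1)%N then (a%:~R + x%:~R * i) / (a%:~R - x%:~R * i)
  else (a%:~R - x%:~R * i) / (a%:~R + x%:~R * i).

Definition locsym (x : int) : nat := qlog i (circ x ^+ qord).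

Lemma norm_split (x : int) :
  (a%:~R + x%:~R * i) * (a%:~R - x%:~R * i) = (a ^+ 2 + x ^+ 2)%:~R.
Proof.
transitivity (a%:~R ^+ 2 - x%:~R ^+ 2 * i ^+ 2); first by ring.
by rewrite hi mulrN1 opprK rmorphD !rmorphXn.
Qed.

Lemma pchar_int_eq0 (n : int) : ((n%:~R : F) == 0) = (q%:Z %| n)%Z.
Proof. by rewrite -(dvdz_pcharf hq). Qed.

Lemma norm_split_neq0 (x : int) : ~~ (q%:Z %| a ^+ 2 + x ^+ 2)%Z ->
  (a%:~R + x%:~R * i != 0) && (a%:~R - x%:~R * i != 0).
Proof. by rewrite -pchar_int_eq0 -norm_split mulf_eq0 negb_or. Qed.

(** Frobenius fixes [a + x i] or conjugates it, so [circ x] lies in the cyclic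
    group of order [q - 1] or [q + 1]. *)
Lemma circ_exp (x : int) : ~~ (q%:Z %| a ^+ 2 + x ^+ 2)%Z ->
  circ x ^+ (4 * qord) = 1.
Proof.
move=> /norm_split_neq0/andP[u0 v0].
have hi4 : i ^+ 4 = 1 by rewrite -[4%N]/(2 * 2)%N exprM hi sqrrN expr1n.
have frob (e : F) : (a%:~R + x%:~R * e) ^+ q = a%:~R + x%:~R * e ^+ q.
  rewrite -(pFrobenius_autE hq) rmorphD rmorphM /= !rmorph_int.
  by rewrite (pFrobenius_autE hq).
have c0 : circ x != 0 by rewrite /circ; case: ifP; rewrite mulf_neq0 ?invr_neq0.
rewrite /circ /qord in c0 *; case: ifP c0 => [/eqP q1|/eqP q1] c0.
  apply: (mulfI c0); rewrite mulr1 -exprS.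
  have -> : (4 * (q.+1 %/ 4)).+1 = q by lia.
  have hiq : i ^+ q = i.
    have -> : q = (4 * (q %/ 4) + 1)%N by lia.
    by rewrite exprD exprM hi4 expr1n mul1r.
  by rewrite expr_div_n -mulrN frob frob exprNn -signr_odd q_odd expr1 hiq mulN1r.
have -> : (4 * (q.+1 %/ 4))%N = q.+1 by lia.
have hiq : i ^+ q = - i.
  have -> : q = (4 * (q %/ 4) + 3)%N by lia.
  by rewrite exprD exprM hi4 expr1n mul1r exprS hi mulrN1.
rewrite exprSr expr_div_n -mulrN frob frob exprNn -signr_odd q_odd expr1 hiq.
by rewrite mulN1r opprK !mulrN mulf_div [X in _ / X]mulrC divff // mulf_neq0.
Qed.

Lemma locsymE (x : int) : ~~ (q%:Z %| a ^+ 2 + x ^+ 2)%Z ->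
  i ^+ locsym x = circ x ^+ qord.
Proof.
by move=> hx; rewrite /locsym qlogK // -exprM mulnC circ_exp.
Qed.

(** The Gauss sums need a [p]-th root of unity in characteristic [q], found in
    an algebraic closure of [F]; the resulting identity involves elements of [F]
    only. *)
Lemma locsym_reciprocity (p : nat) (x : int) :
  prime p -> p%:Z = a ^+ 2 + x ^+ 2 -> (a = 1 %[mod 4])%Z -> (2 %| x)%Z ->
  q != p ->
  ((qstar q)%:~R : 'F_p) ^+ (p %/ 4) = rootN1 p a x ^+ locsym x.
Proof.
move=> p_pr hp ha hx qp.
have p1 := two_squares_mod4 p_pr hp ha hx.
have hf := rootN1_sq p_pr hp ha hx.
have [L [h _]] := countable_algebraic_closure F.
have hqL : q \in [pchar L] by rewrite (rmorph_pchar h).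
have p0 : (p%:R : L) != 0 by rewrite -(dvdn_pcharf hqL) dvdn_prime2.
have [z zp z1] := exists_unity_root p_pr p0.
have hiL : h i ^+ 2 = -1 by rewrite -rmorphXn hi rmorphN1.
have qn0 : ((qstar q)%:~R : 'F_p) != 0.
  have : (q%:R : 'F_p) != 0 by apply: q_neq0.
  by rewrite /qstar; case: ifP; rewrite ?rmorphN /= ?oppr_eq0.
rewrite -(f_qlog p_pr p1 hf qn0); apply/expi_inj => //.
  exact: Fp_two_neq0.
set k := qlog _ _.
have hk : chi (rootN1 p a x) (h i) (qstar q)%:~R = h i ^+ k.
  by apply: (chi_expi p_pr p1 hf hiL); rewrite f_qlog.
have h2 := pchar_odd_two q_pr q_odd hq.
suff e : circ x ^+ qord = i ^+ k by rewrite /locsym e qlog_expi.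
apply: (fmorph_inj h); rewrite /circ /qord !rmorphXn /= -hk /qstar.
case: ifP => [/eqP q1|/eqP q1]; rewrite fmorph_div !(rmorphD, rmorphN, rmorphM) /=;
  rewrite !rmorph_int expr_div_n.
  have E : q = (4 * (q.+1 %/ 4)).+1 by move: q1; clear; lia.
  rewrite -(reciprocity1 p_pr hp ha hx q_pr q_odd qp hqL hiL zp z1 E).
  by rewrite mulfK // expf_neq0 // (pib_neq0 p_pr hp q_pr qp hqL hiL).
have E : (q.+1 = 4 * (q.+1 %/ 4))%N by move: q1 q_odd; clear; lia.
rewrite -(reciprocity3 p_pr hp ha hx q_pr q_odd qp hqL hiL zp z1 E).
by rewrite mulfK // expf_neq0 // (pi_neq0 p_pr hp q_pr qp hqL hiL).
Qed.

End LocalSymbol.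

(** * Supplementary laws *)

Lemma odd_prime_mul_ind (P : nat -> Prop) :
  P 1 -> (forall u v, odd u -> odd v -> P u -> P v -> P (u * v)%N) ->
  forall n, odd n -> (forall q, prime q -> (q %| n)%N -> P q) -> P n.
Proof.
move=> P1 PM; elim/ltn_ind => n IH no hn.
case: (ltngtP n 1) => [|n1|->] //; first by case: n no {IH hn}.
have qp := pdiv_prime n1; have := pdiv_dvd n; set q := pdiv n in qp *.
case/dvdnP=> b hb; rewrite hb oddM in no *.
have /andP[bo qo] := no; have := prime_gt1 qp => q1.
have b0 : (0 < b)%N by case: (b) bo.
apply: PM => //; last by apply: hn => //; rewrite hb dvdn_mull.
apply: IH => //; first by rewrite hb ltn_Pmulr.
by move=> r rp rb; apply: hn => //; rewrite hb dvdn_mulr.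
Qed.

(** For odd [n] this is the negation of [(2 / n) = 1]. *)
Definition pm3_mod8 (n : nat) : bool := (n %% 8 == 3)%N || (n %% 8 == 5)%N.

Lemma pm3_mod8M (u v : nat) : odd u -> odd v ->
  pm3_mod8 (u * v) = pm3_mod8 u (+) pm3_mod8 v.
Proof.
rewrite /pm3_mod8 -(modnMm u v) => uo vo.
have : odd (u %% 8) by lia.
have : odd (v %% 8) by lia.
have : (u %% 8 < 8)%N by rewrite ltn_mod.
have : (v %% 8 < 8)%N by rewrite ltn_mod.
case: (v %% 8)%N => [|[|[|[|[|[|[|[|]]]]]]]] //= _;
by case: (u %% 8)%N => [|[|[|[|[|[|[|[|]]]]]]]].
Qed.

(** In the field with [q ^ 2] elements, as 4 divides [q ^ 2 - 1]. *)
Lemma exists_pchar_field_i (q : nat) : prime q -> odd q ->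
  exists F : finFieldType, q \in [pchar F] /\ exists i : F, i ^+ 2 = -1.
Proof.
move=> q_pr q_odd; have [F hF cF] := pPrimePowerField q_pr (isT : (0 < 2)%N).
exists F; split => //.
have q1 := prime_gt1 q_pr.
have h2 := pchar_odd_two q_pr q_odd hF.
have q4 : (4 %| (q ^ 2).-1)%N.
  have -> : ((q ^ 2).-1 = (q./2 * q./2.+1) * 4)%N.
    by rewrite -{1}(odd_double_half q) q_odd; move: q./2 => j; lia.
  by rewrite dvdn_mull.
have : has (#|F|.-1).-primitive_root (enum (predC1 (0 : F))).
  apply: has_prim_root; first by rewrite cF; nia.
  - apply/allP => y; rewrite mem_enum /= => y0; apply/unity_rootP.
    apply: (mulfI y0); rewrite mulr1 -exprS prednK ?expf_card //.
    by rewrite cF expn_gt0; lia.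
  - exact: enum_uniq.
  - rewrite -cardE; have := cardC1 (0 : F) => h.
    by rewrite -{1}h.
case/hasP => g _; rewrite cF => hg.
have := dvdn_prim_root hg q4.
set i := g ^+ _ => hi; exists i.
have : (i ^+ 2) ^+ 2 == 1 by rewrite -exprM (prim_expr_order hi).
rewrite sqrf_eq1 => /orP[|/eqP//].
by rewrite -(prim_order_dvd hi).
Qed.

Section Supplement.
Variables (p : nat) (a : int) (x : nat).
Hypotheses (p_pr : prime p) (hp : p%:Z = a ^+ 2 + x%:Z ^+ 2).
Hypotheses (ha : (a = 1 %[mod 4])%Z) (hx : ~~ odd x).
Let m := (p %/ 4)%N.
Notation f := (rootN1 p a x%:Z).
Let hx' : (2 %| x%:Z)%Z. Proof. by rewrite dvdzE /= dvdn2. Qed.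
Let p1 := two_squares_mod4 p_pr hp ha hx'.
Let hf : f ^+ 2 = -1 := rootN1_sq p_pr hp ha hx'.
Let a0 := Fp_alpha_neq0 p_pr hp ha hx'.
Let w := (x %/ 2)%N.
Let h2 := Fp_two_neq0 p_pr p1.

Lemma two_squares_quarter : exists2 k : int, a = 4 * k + 1 &
  m%:Z = 4 * k ^+ 2 + 2 * k + w%:Z ^+ 2.
Proof.
exists (a %/ 4)%Z; first by lia.
have hk : a = 4 * (a %/ 4)%Z + 1 by lia.
have hw : x%:Z = 2 * w%:Z by rewrite /w; lia.
have hm : p%:Z = 4 * m%:Z + 1 by rewrite /m; lia.
move: hm; rewrite hp {1}hk hw; move: (a %/ 4)%Z => k hm.
apply: (mulfI (_ : 4 != 0 :> int)) => //.
by apply: (addIr 1); rewrite -hm; ring.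
Qed.

Lemma quartic_neg1 : (-1 : 'F_p) ^+ m = f ^+ (2 * w).
Proof.
have [k _ hm] := two_squares_quarter; have [t ht] := sqr_mod2 w.
by rewrite -hf -exprM; apply/expi_inj => //; lia.
Qed.

(** The square of quartic reciprocity is quadratic reciprocity. *)
Lemma q_quadratic (q : nat) (F : finFieldType) (i : F) :
  prime q -> odd q -> q != p -> q \in [pchar F] -> i ^+ 2 = -1 ->
  exists2 s : nat, (q%:R : 'F_p) ^+ (2 * m) = (-1) ^+ s
    & (circ q a i x ^+ (2 * qord q) = (-1) ^+ s).
Proof.
move=> q_pr q_odd qp hF hi.
exists (locsym q a i x).
  have := locsym_reciprocity q_pr q_odd hF hi p_pr hp ha hx' qp.
  rewrite -/m => /(congr1 (fun t => t ^+ 2)).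
  rewrite -!exprM mulnC [in RHS]mulnC [in RHS]exprM hf => <-.
  by rewrite !exprM /qstar; case: ifP => _; rewrite ?rmorphN /= ?sqrrN.
have qx : ~~ (q%:Z %| a ^+ 2 + x%:Z ^+ 2)%Z by rewrite -hp dvdzE /= dvdn_prime2.
by rewrite mulnC exprM -(locsymE q_pr q_odd hF hi qx) exprAC hi.
Qed.

Lemma prime_dvd_alpha (q : nat) : prime q -> (q%:Z %| a)%Z -> q != p.
Proof.
by move=> q_pr qa; apply: contraNneq a0 => qp; rewrite Fp_int_eq0 // -qp.
Qed.

Lemma alpha_odd : odd `|a|. Proof. lia. Qed.

Lemma prime_odd_dvd (q n : nat) : odd n -> (q %| n)%N -> odd q.
Proof. by move=> no /dvdnP[k nk]; move: no; rewrite nk oddM => /andP[]. Qed.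

Lemma nat_abs_pow (K : pzRingType) (n : int) (k : nat) :
  (`|n|%N%:R : K) ^+ (2 * k) = n%:~R ^+ (2 * k).
Proof. by case: n => n; rewrite // NegzE rmorphN /= !exprM sqrrN. Qed.

(** Every prime factor [q] of [a] has [(q / p) = (p / q) = (x ^ 2 / q) = 1]. *)
Lemma alpha_residue : (a%:~R : 'F_p) ^+ (2 * m) = 1.
Proof.
rewrite -nat_abs_pow; move: alpha_odd.
have key q : prime q -> (q %| `|a|)%N -> (q%:R : 'F_p) ^+ (2 * m) = 1.
  move=> q_pr qa; have q_odd := prime_odd_dvd alpha_odd qa.
  have qp : q != p by apply: prime_dvd_alpha; rewrite // dvdzE.
  have [F [hF [i hi]]] := exists_pchar_field_i q_pr q_odd.
  have [s -> hs] := q_quadratic q_pr q_odd qp hF hi.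
  (* [a = 0] in [F], so the quotient [circ] is [x i / (- x i) = -1]. *)
  have aF : (a%:~R : F) = 0 by apply/eqP; rewrite (pchar_int_eq0 hF) dvdzE.
  have qx : ~~ (q%:Z %| a ^+ 2 + x%:Z ^+ 2)%Z by rewrite -hp dvdzE /= dvdn_prime2.
  have /andP[] := norm_split_neq0 hF hi qx; rewrite aF add0r => u0 _.
  move: hs; rewrite /circ aF add0r sub0r invrN mulrN mulNr divff // if_same.
  rewrite exprM sqrrN !expr1n -hi -exprM -(expr0 i) => /expi_inj hs.
  have {}hs := hs hi (pchar_odd_two q_pr q_odd hF).
  rewrite -signr_odd; have -> // : odd s = false by move: hs; clear; lia.
move=> ao; apply: (odd_prime_mul_ind (P := fun n => (n%:R : 'F_p) ^+ (2 * m) = 1)) => //.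
  by rewrite expr1n.
by move=> u v _ _ hu hv; rewrite natrM exprMn hu hv mulr1.
Qed.

Lemma alpha_plus_odd : odd `|(a + x%:Z)%R|. Proof. lia. Qed.

(** A prime factor [q] of [a + x] satisfies
    [(q / p) = (p / q) = (2 a ^ 2 / q) = (2 / q)]. *)
Lemma alpha_plus_prime (q : nat) : prime q -> (q %| `|(a + x%:Z)%R|)%N ->
  (q%:R : 'F_p) ^+ (2 * m) = (-1) ^+ pm3_mod8 q.
Proof.
move=> q_pr qa; have q_odd := prime_odd_dvd alpha_plus_odd qa.
have qp : q != p.
  apply: contraTneq qa => ->; rewrite -[(_ %| _)%N]/((p%:Z %| a + x%:Z)%Z).
  rewrite -Fp_int_eq0 // rmorphD /= -(rootN1_mul p_pr hp ha hx') -{1}[a%:~R]mul1r.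
  rewrite -mulrDl mulf_neq0 // addr_eq0; apply: contraNneq h2 => e.
  move: hf; rewrite -[f]opprK -e sqrrN expr1n => e'.
  by rewrite -[2]/(1 + 1 : 'F_p) {1}e' addNr.
have [F [hF [i hi]]] := exists_pchar_field_i q_pr q_odd.
have [s -> hs] := q_quadratic q_pr q_odd qp hF hi.
have xF : (x%:~R : F) = - a%:~R.
  apply/eqP; rewrite -addr_eq0 addrC -rmorphD /=.
  by rewrite (pchar_int_eq0 hF) dvdzE.
have qx : ~~ (q%:Z %| a ^+ 2 + x%:Z ^+ 2)%Z by rewrite -hp dvdzE /= dvdn_prime2.
(* [x = - a] in [F], so [circ] is a square root of -1. *)
have c2 : circ q a i x ^+ 2 = -1.
  rewrite /circ xF; have /andP[] := norm_split_neq0 hF hi qx; rewrite xF.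
  have -> : a%:~R + - a%:~R * i = a%:~R * (1 - i) by ring.
  have -> : a%:~R - - a%:~R * i = a%:~R * (1 + i) by ring.
  rewrite !mulf_eq0 !negb_or => /andP[aF u0] /andP[_ v0].
  have e (u v : F) : u != 0 -> v != 0 -> u ^+ 2 = - v ^+ 2 -> (u / v) ^+ 2 = -1.
    by move=> u1 v1 uv; rewrite expr_div_n uv mulNr divff // expf_neq0.
  case: ifP => _; apply: e; rewrite ?mulf_neq0 // !exprMn;
    rewrite sqrrB sqrrD hi expr1n; ring.
move: hs; rewrite exprM c2 -hi -!exprM => /expi_inj hs.
have {}hs := hs hi (pchar_odd_two q_pr q_odd hF).
rewrite -signr_odd; congr (_ ^+ nat_of_bool _).
rewrite /pm3_mod8; move: hs q_odd; rewrite /qord; clear; lia.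
Qed.

Lemma alpha_plus_residue :
  ((a + x%:Z)%:~R : 'F_p) ^+ (2 * m) = (-1) ^+ pm3_mod8 `|(a + x%:Z)%R|.
Proof.
rewrite -nat_abs_pow.
apply: (odd_prime_mul_ind (P := fun n => (n%:R : 'F_p) ^+ (2 * m) = (-1) ^+ pm3_mod8 n)).
- by rewrite expr1n.
- move=> u v uo vo hu hv; rewrite natrM exprMn hu hv pm3_mod8M //.
  by rewrite signr_addb.
- exact: alpha_plus_odd.
- exact: alpha_plus_prime.
Qed.

(** Dirichlet's argument: [(a + x) ^ 2 = 2 a ^ 2 f] modulo [p], and the quadratic
    characters of [a] and [a + x] are known. *)
Lemma quartic_two : (2 : 'F_p) ^+ m = f ^+ w.
Proof.
have [k hk hm] := two_squares_quarter.
have e : ((a + x%:Z)%:~R : 'F_p) ^+ (2 * m) = 2 ^+ m * f ^+ m.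
  rewrite exprM -exprMn -[RHS]mulr1 -[X in _ = _ * X]alpha_residue [X in _ = _ * X]exprM -exprMn; congr (_ ^+ m).
  rewrite rmorphD /= -(rootN1_mul p_pr hp ha hx').
  transitivity (a%:~R ^+ 2 * (f ^+ 2 + 1 + 2 * f)); first by ring.
  by rewrite hf addNr add0r mulrC.
apply: (mulIf (expi_neq0 hf m)); rewrite -e alpha_plus_residue -hf -exprM -exprD.
apply/(expi_inj hf h2).
have hw : x%:Z = 2 * w%:Z by rewrite /w; lia.
(* Put [v = 2 k + w].  Then [a + x = 2 v + 1], and the exponents on both sides
   are [v ^ 2 + v] modulo 4, which depends on [v] modulo 4. *)
have [t [r [ht hr]]] : exists t : int, exists r : nat,
    2 * k + w%:Z = 4 * t + r%:Z /\ (r < 4)%N.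
  by exists ((2 * k + w%:Z) %/ 4)%Z, `|((2 * k + w%:Z) %% 4)%Z|%N; lia.
have wE : w%:Z = 4 * t + r%:Z - 2 * k by lia.
have h8 : a + x%:Z = 8 * t + 2 * r%:Z + 1 by lia.
have [g hg] : exists g : int, (w + m)%N%:Z = r%:Z ^+ 2 + r%:Z + 4 * g.
  exists (2 * k ^+ 2 - k * (4 * t + r%:Z) + 4 * t ^+ 2 + 2 * t * r%:Z + t).
  by rewrite PoszD hm wE; ring.
rewrite /pm3_mod8 h8; move: hg; move: (w + m)%N => n; clear -hr.
case: r hr => [|[|[|[|]]]] //= _ hn; lia.
Qed.
End Supplement.

(** * Local sums *)

Section LocalSums.
Variables (q : nat) (a : int) (F : finFieldType) (i : F).
Hypotheses (q_pr : prime q) (q_odd : odd q).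
Hypotheses (hq : q \in [pchar F]) (hi : i ^+ 2 = -1).
Let n := qord q.
Let h2 : (2 : F) != 0 := pchar_odd_two q_pr q_odd hq.

Let n_gt0 : (0 < n)%N.
Proof. by have := prime_gt1 q_pr; rewrite /n /qord; lia. Qed.

Lemma tau_qord : (tau q).+1 = (4 * n)%N.
Proof. by have := prime_gt1 q_pr; rewrite /n /qord /tau; case: eqP; lia. Qed.

Definition coprime_res : {set 'I_q} :=
  [set y : 'I_q | ~~ (q%:Z %| a ^+ 2 + y%:Z ^+ 2)%Z].

Definition local_sum (k : nat) : algC :=
  \sum_(y in coprime_res) 'i ^+ (k * locsym q a i y%:Z).

Lemma qord_parity : odd n = pm3_mod8 q.
Proof. by rewrite /n /qord /pm3_mod8; lia. Qed.

Lemma ord_pchar_inj : injective (fun y : 'I_q => (y%:Z)%:~R : F).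
Proof.
move=> y y' /eqP; rewrite -subr_eq0 -rmorphB /= (pchar_int_eq0 hq).
rewrite -eqz_mod_dvd !modz_small ?ltz_nat ?ltn_ord ?lez_nat // => /eqP[].
exact: val_inj.
Qed.

Section Ramified.
Hypothesis qa : (q%:Z %| a)%Z.

Lemma coprime_res_ramified : coprime_res = [set~ Ordinal (prime_gt0 q_pr)].
Proof.
apply/setP => y; rewrite !inE; congr (~~ _).
rewrite -!(pchar_int_eq0 hq) rmorphD !rmorphXn /=.
have /eqP-> : a%:~R == 0 :> F by rewrite (pchar_int_eq0 hq).
rewrite expr0n add0r sqrf_eq0 -(inj_eq ord_pchar_inj) /= //.
Qed.

(** Here [circ] is constantly [-1]. *)
Lemma local_sum_ramified k :
  local_sum k = (q.-1)%:R * (-1) ^+ (k * pm3_mod8 q).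
Proof.
rewrite /local_sum (eq_bigr (fun=> (-1) ^+ (k * pm3_mod8 q))).
  by rewrite sumr_const coprime_res_ramified cardsC1 card_ord mulr_natl.
move=> y; rewrite inE => hy.
have e : i ^+ locsym q a i y%:Z = i ^+ (2 * n).
  rewrite (locsymE q_pr q_odd hq hi hy).
  have aF : (a%:~R : F) = 0 by apply/eqP; rewrite (pchar_int_eq0 hq).
  have /andP[] := norm_split_neq0 hq hi hy; rewrite aF add0r => u0 _.
  by rewrite /circ aF add0r sub0r invrN mulrN mulNr divff // if_same exprM hi.
have {}e := (expi_inj hi h2 _ _).1 e.
rewrite -(sqrCi algC) -exprM; apply/expi_inj; rewrite ?sqrCi ?pnatr_eq0 //.
rewrite -modnMmr e modnMmr -qord_parity.
by have := odd_double_half n; move: (n) (odd n) => n' b; clear; lia.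
Qed.
End Ramified.

Section Unramified.
Hypothesis qa : ~~ (q%:Z %| a)%Z.
Let a0 : (a%:~R : F) != 0. Proof. by rewrite (pchar_int_eq0 hq). Qed.
Let i0 : i != 0. Proof. by have := expi_neq0 hi 1. Qed.

Definition circle : {set F} := [set u : F | u ^+ (4 * n) == 1].

Lemma card_circle : (#|circle| <= 4 * n)%N.
Proof.
rewrite cardE; apply: max_unity_roots; rewrite ?muln_gt0 ?n_gt0 ?enum_uniq //.
by apply/allP => u; rewrite mem_enum inE unity_rootE.
Qed.

Lemma coprime_resP (y : 'I_q) : y \in coprime_res ->
  (a%:~R + (y%:Z)%:~R * i != 0 :> F) && (a%:~R - (y%:Z)%:~R * i != 0 :> F).
Proof. by rewrite inE => /(norm_split_neq0 hq hi). Qed.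

Lemma circ_inj : {in coprime_res &, injective (fun y : 'I_q => circ q a i y%:Z)}.
Proof.
move=> y y' /coprime_resP/andP[u0 v0] /coprime_resP/andP[u0' v0'] h.
apply: ord_pchar_inj.
have {}h : (a%:~R + (y%:Z)%:~R * i) * (a%:~R - (y'%:Z)%:~R * i) =
           (a%:~R + (y'%:Z)%:~R * i) * (a%:~R - (y%:Z)%:~R * i).
  move: h; rewrite /circ; case: ifP => _ /eqP; rewrite eqr_div // => /eqP //.
  by move=> h; rewrite mulrC -h mulrC.
have : 2 * a%:~R * i * ((y%:Z)%:~R - (y'%:Z)%:~R) = 0.
  by move/eqP: h; rewrite -subr_eq0 => /eqP <-; ring.
by move/eqP; rewrite !mulf_eq0 (negbTE h2) (negbTE a0) (negbTE i0) subr_eq0 => /eqP.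
Qed.

Lemma circ_neqN1 (y : 'I_q) : y \in coprime_res -> circ q a i y%:Z != -1.
Proof.
move=> /coprime_resP/andP[u0 v0].
have h : 2 * a%:~R != 0 :> F by rewrite mulf_neq0.
have e (u v : F) : v != 0 -> u + v != 0 -> u / v != -1.
  by move=> v1; apply: contra_neq => uv; rewrite -[u](divfK v1) uv mulN1r addNr.
rewrite /circ; case: ifP => _; apply: e => //; apply: contra_neq h => <-; ring.
Qed.

(** At most two residues are excluded, namely square roots of [- a ^ 2], and
    none if [q = 3 mod 4]. *)
Lemma card_coprime_res_ge : (4 * n <= #|coprime_res|.+1)%N.
Proof.
rewrite -tau_qord ltnS -(leq_add2r #|~: coprime_res|) cardsC card_ord.
set Z := (~: _).
have hZ (y : 'I_q) : y \in Z -> (y%:Z)%:~R \in [set a%:~R * i; - (a%:~R * i)].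
  rewrite !inE negbK -(pchar_int_eq0 hq) rmorphD !rmorphXn /= addrC addr_eq0.
  by rewrite -eqf_sqr exprMn hi mulrN1.
have := prime_gt1 q_pr => q1.
have cZ : (#|Z| <= 2)%N.
  rewrite -(card_imset _ ord_pchar_inj).
  apply: (@leq_trans #|[set a%:~R * i; - (a%:~R * i)]|).
    by apply: subset_leq_card; apply/fintype.subsetP => u /imsetP[y /hZ hy ->].
  by rewrite cards2; case: (_ == _).
rewrite /tau; case: eqP => q3; last by lia.
have -> : Z = finset.set0; last by rewrite cards0; lia.
apply/setP => y; rewrite finset.in_set0; apply/negbTE/negP => /hZ.
have hi4 : i ^+ 4 = 1 by rewrite -[4%N]/(2 * 2)%N exprM hi sqrrN expr1n.
have hiq : i ^+ q = - i.
  have -> : q = (4 * (q %/ 4) + 3)%N by lia.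
  by rewrite exprD exprM hi4 expr1n mul1r exprS hi mulrN1.
have frob (e : int) : (e%:~R : F) ^+ q = e%:~R.
  by rewrite -(pFrobenius_autE hq) rmorph_int.
rewrite inE; set c := a%:~R * i.
have cq : c ^+ q = - c by rewrite exprMn frob hiq mulrN.
have cq' : (- c) ^+ q = c by rewrite exprNn cq -signr_odd q_odd expr1 mulN1r opprK.
have c0 : c != - c.
  by rewrite -subr_eq0 opprK -mulr2n -mulr_natl !mulf_neq0.
rewrite !inE => /orP[]/eqP hy; have := frob y%:Z; rewrite hy ?cq ?cq' => /eqP.
  by rewrite eq_sym (negbTE c0).
by rewrite (negbTE c0).
Qed.

(** [circ] parametrizes the circle without [-1], the point at infinity.  It is
    injective, its image avoids [-1], and the two cardinalities leave no room. *)
Lemma circ_imset :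
  [set circ q a i (y : 'I_q)%:Z | y in coprime_res] = circle :\ -1
  /\ #|coprime_res| = tau q.
Proof.
set I := [set _ | _ in _].
have sI : I \subset circle :\ -1.
  apply/fintype.subsetP => u /imsetP[y hy ->]; rewrite !inE circ_neqN1 //=.
  by rewrite inE in hy; rewrite circ_exp.
have N1 : -1 \in circle by rewrite inE exprM -[4%N]/(2 * 2)%N exprM sqrrN !expr1n.
have cI : #|I| = #|coprime_res| by apply: card_in_imset; apply: circ_inj.
have := card_circle; rewrite (cardsD1 (-1)) N1 add1n => cC.
have cge := card_coprime_res_ge; have ct := tau_qord.
have le := subset_leq_card sI.
have cT : #|coprime_res| = tau q.
  apply: anti_leq; apply/andP; split; last by rewrite -ltnS ct.
  rewrite -ltnS ct -cI; exact: leq_trans cC.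
split=> //; apply/eqP; rewrite eqEcard sI /= cI cT -ltnS ct.
exact: cC.
Qed.

Lemma card_circleE : #|circle| = (4 * n)%N.
Proof.
have [hI c] := circ_imset.
have N1 : -1 \in circle by rewrite inE exprM -[4%N]/(2 * 2)%N exprM sqrrN !expr1n.
rewrite (cardsD1 (-1)) N1 -hI card_in_imset ?c; last exact: circ_inj.
exact: tau_qord.
Qed.

Definition circle_char (k : nat) (u : F) : algC := 'i ^+ (k * qlog i (u ^+ n)).

Lemma circle_qlog u : u \in circle -> i ^+ qlog i (u ^+ n) = u ^+ n.
Proof. by rewrite inE => /eqP h; rewrite qlogK // -exprM mulnC. Qed.

Lemma circle_charM k u v : u \in circle -> v \in circle ->
  circle_char k (u * v) = circle_char k u * circle_char k v.
Proof.
move=> hu hv; rewrite /circle_char -exprD -mulnDr.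
apply/expi_inj; rewrite ?sqrCi ?pnatr_eq0 // -modnMmr -[RHS]modnMmr.
congr ((_ * _) %% _)%N; apply/(expi_inj hi h2).
rewrite exprD !circle_qlog ?exprMn //; move: hu hv; rewrite !inE exprMn.
by move=> /eqP-> /eqP->; rewrite mulr1.
Qed.

(** A generator of the circle has a value different from 1 under every power of
    the quartic character that is not trivial. *)
Lemma circle_char_sum k : ~~ (4 %| k)%N -> \sum_(u in circle) circle_char k u = 0.
Proof.
move=> hk.
have : has (4 * n).-primitive_root (enum circle).
  apply: has_prim_root; rewrite ?muln_gt0 ?n_gt0 ?enum_uniq //.
    by apply/allP => u; rewrite mem_enum inE unity_rootE.
  by rewrite -cardE card_circleE.
case/hasP => g; rewrite mem_enum => gC hg.
have g0 : g != 0.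
  apply: contraTneq gC => ->; rewrite inE expr0n muln_eq0 /=.
  by case: n n_gt0 => //= *; rewrite eq_sym oner_eq0.
have hg1 : circle_char k g - 1 != 0.
  rewrite subr_eq0 /circle_char expi_eq1 ?sqrCi ?pnatr_eq0 //.
  have e : i ^+ (2 * qlog i (g ^+ n)) = i ^+ 2.
    rewrite mulnC exprM circle_qlog // hi -exprM.
    have : (g ^+ (n * 2)) ^+ 2 == 1.
      by rewrite -exprM; have := gC; rewrite inE => /eqP {1}<-; apply/eqP;
        congr (_ ^+ _); clear; lia.
    rewrite sqrf_eq1 => /orP[|/eqP//].
    rewrite -(prim_order_dvd hg) => /dvdn_leq; rewrite muln_gt0 n_gt0.
    by move: n_gt0; clear; lia.
  have {}e := (expi_inj hi h2 _ _).1 e.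
  have : odd (qlog i (g ^+ n)) by move: e; clear; lia.
  move: (qlog _ _) => s so; rewrite Gauss_dvdl //.
  by rewrite -[4%N]/(2 ^ 2)%N coprimeXl // coprime2n.
apply: (mulfI hg1); rewrite mulr0 mulrBl mul1r mulr_sumr.
rewrite [X in _ - X](reindex_inj (mulfI g0)) /=.
apply/eqP; rewrite subr_eq0; apply/eqP; apply: eq_big => u.
  by rewrite !inE exprMn; have := gC; rewrite inE => /eqP->; rewrite mul1r.
by move=> uC; rewrite circle_charM.
Qed.

(** The sum over the whole circle vanishes, so the local sum is minus the value
    at the missing point [-1]. *)
Lemma local_sum_unramified k : local_sum k =
  if (4 %| k)%N then (tau q)%:R else - (-1) ^+ (k * pm3_mod8 q).
Proof.
have [hI c] := circ_imset.
case: ifP => [h4|/negbT h4].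
  rewrite /local_sum -c -sum1_card natr_sum; apply: eq_bigr => y _.
  apply/eqP; rewrite expi_eq1 ?sqrCi ?pnatr_eq0 //; exact: dvdn_mulr.
have N1 : -1 \in circle by rewrite inE exprM -[4%N]/(2 * 2)%N exprM sqrrN !expr1n.
have := circle_char_sum h4; rewrite (big_setD1 _ N1) /= -hI big_imset /=; last exact: circ_inj.
move/eqP; rewrite addr_eq0 => /eqP e.
transitivity (- circle_char k (-1)); first by rewrite e opprK.
congr (- _); rewrite /circle_char -(sqrCi algC) -exprM.
apply/expi_inj; rewrite ?sqrCi ?pnatr_eq0 //.
have e2 : i ^+ qlog i ((-1) ^+ n) = i ^+ (2 * n) by rewrite circle_qlog // exprM hi.
have {}e2 := (expi_inj hi h2 _ _).1 e2.
rewrite -modnMmr e2 modnMmr -qord_parity.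
by have := odd_double_half n; move: (n) (odd n) => n' b; clear; lia.
Qed.

End Unramified.
End LocalSums.

(** The local sums as integers: they are real, although the summands are not. *)
Definition local_value (a : int) (q k : nat) : int :=
  if (q%:Z %| a)%Z then (q.-1)%:Z * (-1) ^+ (k * pm3_mod8 q)
  else if (4 %| k)%N then (tau q)%:Z else - (-1) ^+ (k * pm3_mod8 q).

(** The interface between the arithmetic at [q] and the counting of classes:
    reciprocity makes the quartic character of [qstar q] modulo [p] a function
    of [x] modulo [q], and the sums of its powers are known. *)
Definition is_local_symbol (a : int) (q : nat) (c : nat -> nat) : Prop :=
  (forall p x, prime p -> p%:Z = a ^+ 2 + x%:Z ^+ 2 -> ~~ odd x -> q != p ->
    ((qstar q)%:~R : 'F_p) ^+ (p %/ 4) = rootN1 p a x%:Z ^+ c (x %% q)%N) /\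
  (forall k, \sum_(y < q | ~~ (q%:Z %| a ^+ 2 + y%:Z ^+ 2)%Z) ('i : algC) ^+ (k * c y)
     = (local_value a q k)%:~R).

Lemma exists_local_symbol (a : int) (q : nat) : (a = 1 %[mod 4])%Z ->
  prime q -> odd q -> exists c, is_local_symbol a q c.
Proof.
move=> ha q_pr q_odd.
have [F [hq [i hi]]] := exists_pchar_field_i q_pr q_odd.
exists (fun y => locsym q a i y%:Z); split.
  move=> p x p_pr hp xe qp.
  have hx' : (2 %| x%:Z)%Z by rewrite dvdzE /= dvdn2.
  have -> : locsym q a i (x %% q)%N%:Z = locsym q a i x%:Z.
    have e : ((x %% q)%N%:Z%:~R : F) = (x%:Z)%:~R.
      rewrite [in RHS](divn_eq x q) PoszD PoszM rmorphD rmorphM /=.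
      by rewrite (_ : (q%:Z%:~R : F) = 0) ?mulr0 ?add0r //; exact: pcharf0.
    by rewrite /locsym /circ e.
  exact: (locsym_reciprocity q_pr q_odd hq hi).
move=> k; transitivity (local_sum q a i k).
  by apply: eq_bigl => y; rewrite inE.
rewrite /local_value; case: ifP => [qa|/negbT qa].
  by rewrite (local_sum_ramified q_pr q_odd hq hi qa) rmorphM rmorphXn rmorphN1.
rewrite (local_sum_unramified q_pr q_odd hq hi qa); case: ifP => // _.
by rewrite rmorphN rmorphXn rmorphN1.
Qed.

(** * Chinese remainders *)

Lemma crt_sum (R : comPzRingType) (m n : nat) (F G : nat -> R) :
  coprime m n -> (0 < m)%N -> (0 < n)%N ->
  \sum_(x < m * n) F (x %% m)%N * G (x %% n)%N =
  (\sum_(x < m) F x) * (\sum_(x < n) G x).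
Proof.
move=> cop m0 n0; rewrite big_distrlr pair_big /=.
pose h (x : 'I_(m * n)) := (Ordinal (ltn_pmod x m0), Ordinal (ltn_pmod x n0)).
have h_inj : injective h.
  move=> x y [/eqP hm /eqP hn]; apply: val_inj => /=.
  have : x == y %[mod m * n] by rewrite chinese_remainder // hm hn.
  by rewrite !modn_small // => /eqP.
have h_bij : bijective h by apply: inj_card_bij; rewrite // card_prod !card_ord.
by rewrite (reindex h) //; apply: onW_bij.
Qed.

(** The factor [H] at the modulus [m] absorbs one prime after the other in the
    induction; it is used with [m = 8]. *)
Lemma crt_sum_seq (R : comPzRingType) (I : eqType) (L : seq I) (u : I -> nat)
    (F : I -> nat -> R) (m : nat) (H : nat -> R) :
  (0 < m)%N -> all (fun z => (0 < u z)%N) L -> pairwise coprime (map u L) ->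
  all (fun z => coprime m (u z)) L ->
  \sum_(x < m * \prod_(z <- L) u z)
      H (x %% m)%N * \prod_(z <- L) F z (x %% u z)%N =
  (\sum_(x < m) H x) * \prod_(z <- L) \sum_(x < u z) F z x.
Proof.
elim: L m H => [|z L IH] m H m0 /=.
  rewrite !big_nil muln1 mulr1 => _ _ _; apply: eq_bigr => x _.
  by rewrite big_nil mulr1 modn_small.
move=> /andP[z0 hL] /andP[zc hc] /andP[mz hm].
have E := IH (m * u z)%N (fun y => H (y %% m)%N * F z (y %% u z)%N).
rewrite [in LHS]big_cons mulnA [in RHS]big_cons mulrA.
rewrite -(crt_sum H (F z) mz m0 z0) -E ?muln_gt0 ?m0 //.
  apply: eq_bigr => x _; rewrite big_cons mulrA; congr (_ * _ * _).
    by rewrite modn_dvdm // dvdn_mulr.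
  by rewrite modn_dvdm // dvdn_mull.
apply/allP => y yL; rewrite coprimeMl (allP hm) //=.
by apply: (allP zc); rewrite map_f.
Qed.

(** * Counting residue classes *)

Section ClassCount.
Variables (a : int) (L : seq (nat * nat)) (c : nat -> nat -> nat) (s : nat).
Hypotheses (Lp : all (fun z => prime z.1 && odd z.1) L).
Hypotheses (Lu : uniq (map fst L)).
Hypotheses (hc : forall z, z \in L -> is_local_symbol a z.1 (c z.1)).

(** The factor 8 makes [x / 2] well defined modulo 4. *)
Definition modulus : nat := 8 * \prod_(z <- L) z.1.

Definition good_class (x : nat) : bool :=
  ~~ odd x && all (fun z => ~~ (z.1%:Z %| a ^+ 2 + x%:Z ^+ 2)%Z) L.

(** The exponent of [chi D]: the factors [-1] and [2] of [D] contribute the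
    multiple [s] of [x / 2], and [qstar q ^ e] contributes [e] times the local
    symbol. *)
Definition class_exp (x : nat) : nat :=
  s * (x %% 8 %/ 2) + \sum_(z <- L) z.2 * c z.1 (x %% z.1).

Lemma sqr_dvd_mod (q x : nat) :
  (q%:Z %| a ^+ 2 + (x %% q)%N%:Z ^+ 2)%Z = (q%:Z %| a ^+ 2 + x%:Z ^+ 2)%Z.
Proof.
set r := (x %% q)%N; set t := (x %/ q)%N.
have -> : a ^+ 2 + x%:Z ^+ 2 =
    a ^+ 2 + r%:Z ^+ 2 + (t%:Z * (2 * r%:Z + t%:Z * q%:Z)) * q%:Z.
  by rewrite [in LHS](divn_eq x q) PoszD PoszM -/r -/t; ring.
by rewrite [RHS]rpredDr // dvdz_mull.
Qed.

Lemma class_sum (j : nat) :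
  \sum_(x < modulus | good_class x) ('i : algC) ^+ (j * class_exp x) =
  (if (4 %| j * s)%N then 4 else 0)
   * (\prod_(z <- L) local_value a z.1 (j * z.2))%:~R.
Proof.
pose H (y : nat) : algC := if odd y then 0 else 'i ^+ (j * s * (y %/ 2)).
pose F (z : nat * nat) (y : nat) : algC :=
  if ~~ (z.1%:Z %| a ^+ 2 + y%:Z ^+ 2)%Z then 'i ^+ (j * z.2 * c z.1 y) else 0.
have -> : \sum_(x < modulus | good_class x) ('i : algC) ^+ (j * class_exp x)
   = \sum_(x < modulus) H (x %% 8)%N * \prod_(z <- L) F z (x %% z.1)%N.
  rewrite big_mkcond; apply: eq_bigr => x _; rewrite /H.
  have -> : odd (x %% 8) = odd x by lia.
  rewrite /good_class; case: (odd x); first by rewrite mul0r.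
  rewrite /= /class_exp mulnDr exprD mulnA.
  case: allP => [hL|hL].
    rewrite big_distrr expr_sum /=; congr (_ * _).
    apply: eq_big_seq => z zL; rewrite /F sqr_dvd_mod hL //.
    by rewrite mulnA.
  have [z zL hz] : exists2 z, z \in L & (z.1%:Z %| a ^+ 2 + x%:Z ^+ 2)%Z.
    by have /allPn[z zL] := introN allP hL; rewrite negbK; exists z.
  by rewrite (big_rem z) //= {1}/F sqr_dvd_mod hz /= !(mul0r, mulr0).
rewrite crt_sum_seq //; first last.
- apply/allP => z /(allP Lp)/andP[zp zo].
  by rewrite -[8%N]/(2 ^ 3)%N coprimeXl // coprime2n.
- apply/(pairwiseP 0%N) => i k; rewrite !inE => ik kk lik.
  have [hi hk] : prime (nth 0%N (map fst L) i) /\ prime (nth 0%N (map fst L) k).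
    have P q : q \in map fst L -> prime q by case/mapP => z /(allP Lp)/andP[? _] ->.
    by split; apply: P; rewrite mem_nth.
  rewrite prime_coprime // dvdn_prime2 // nth_uniq //.
  by rewrite neq_ltn lik.
- by apply/allP => z /(allP Lp)/andP[/prime_gt0].
congr (_ * _).
  have w4 : (('i : algC) ^+ (j * s)) ^+ 4 = 1.
    by rewrite exprAC -[4%N]/(2 * 2)%N [X in X ^+ _]exprM sqrCi sqrrN !expr1n.
  transitivity (\sum_(t < 4) ('i ^+ (j * s) : algC) ^+ t).
    rewrite 8!big_ord_recl big_ord0 4!big_ord_recl big_ord0 /H /=.
    by rewrite !exprM !(add0r, addr0).
  case: ifP => [h4|/negbT h4].
    have /eqP -> : ('i : algC) ^+ (j * s) == 1.
      by rewrite expi_eq1 ?sqrCi ?pnatr_eq0.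
    by under eq_bigr => t _ do rewrite expr1n; rewrite sumr_const card_ord.
  have w1 : ('i : algC) ^+ (j * s) - 1 != 0.
    by rewrite subr_eq0 expi_eq1 ?sqrCi ?pnatr_eq0.
  by apply: (mulfI w1); rewrite -subrX1 w4 subrr mulr0.
rewrite rmorph_prod; apply: eq_big_seq => z zL /=.
have [_ <-] := hc zL.
by rewrite /F -big_mkcond.
Qed.

Definition value_prod (k : nat) : int := \prod_(z <- L) local_value a z.1 (k * z.2).

Lemma value_prod3 : value_prod 3 = value_prod 1.
Proof.
apply: eq_bigr => z _; rewrite /local_value mul1n.
have -> : (4 %| 3 * z.2)%N = (4 %| z.2)%N by rewrite Gauss_dvdr.
have e b : (-1 : int) ^+ (3 * z.2 * b) = (-1) ^+ (z.2 * b).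
  by rewrite -mulnA exprM -signr_odd.
by rewrite e.
Qed.

Lemma card_good_class : #|[set x : 'I_modulus | good_class x]|%:Z = 4 * value_prod 0.
Proof.
apply/eqP; rewrite -(eqr_int algC) -sum1dep_card.
have := class_sum 0; rewrite mul0n dvdn0 /= rmorphM /= -/(value_prod 0) => <-.
by rewrite -natz natr_sum rmorph_sum /=; apply/eqP/eq_bigr => x _; rewrite mul0n.
Qed.

(** Orthogonality of the powers of the quartic character; the first and the
    third power have equal sums by [value_prod3]. *)
Lemma card_class_exp (b : bool) :
  #|[set x : 'I_modulus | good_class x && (class_exp x %% 4 == 2 * b)%N]|%:Z =
  value_prod 0 + (~~ odd s)%:Z * value_prod 2
    + (-1) ^+ b * (2 * (4 %| s)%N%:Z * value_prod 1).
Proof.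
have h4 : (4 : int) != 0 by [].
apply: (mulfI h4); apply/eqP; rewrite -(eqr_int algC) -sum1dep_card.
have key (k : nat) : \sum_(j < 4) ('i : algC) ^+ (j * (k + 2 * b)) =
    if (k %% 4 == 2 * b)%N then 4 else 0.
  have I2 := sqrCi algC; have n2 : (2 : algC) != 0 by rewrite pnatr_eq0.
  set w := ('i : algC) ^+ (k + 2 * b).
  have w4 : w ^+ 4 = 1 by rewrite /w exprAC -[4%N]/(2 * 2)%N [X in X ^+ _]exprM sqrCi sqrrN !expr1n.
  transitivity (\sum_(j < 4) w ^+ j).
    by apply: eq_bigr => j _; rewrite mulnC exprM.
  have -> : (k %% 4 == 2 * b)%N = (4 %| k + 2 * b)%N by case: b {w w4}; lia.
  case: ifP => [hk|/negbT hk].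
    have /eqP -> : w == 1 by rewrite /w expi_eq1.
    by under eq_bigr => t _ do rewrite expr1n; rewrite sumr_const card_ord.
  have w1 : w - 1 != 0 by rewrite subr_eq0 /w expi_eq1.
  by apply: (mulfI w1); rewrite -subrX1 w4 subrr mulr0.
transitivity (\sum_(j < 4) (-1) ^+ (j * b) *
   \sum_(x < modulus | good_class x) ('i : algC) ^+ (j * class_exp x) == 
   (4 * (value_prod 0 + ((~~ odd s)%:Z * value_prod 2) + (-1) ^+ b * (2 * (4 %| s)%N%:Z * value_prod 1)))%:~R).
  congr (_ == _).
  under [RHS]eq_bigr => j _ do rewrite mulr_sumr.
  rewrite exchange_big /= rmorphM -natz natr_sum rmorph_sum mulr_sumr big_mkcondr /=.
  apply: eq_bigr => x _.
  transitivity (if (class_exp x %% 4 == 2 * b)%N then 4 else 0 : algC).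
    by case: ifP; rewrite ?mulr1.
  rewrite -key; apply: eq_bigr => j _.
  rewrite mulnDr exprD mulrC; congr (_ * _).
  by rewrite mulnA [(j * 2)%N]mulnC -mulnA exprM sqrCi.
rewrite !big_ord_recl big_ord0 /=.
rewrite -[bump 0 0]/1%N -[bump 0 1]/2%N -[bump 0 2]/3%N.
rewrite !class_sum -!/(value_prod _) value_prod3.
have -> : (4 %| 2 * s)%N = ~~ odd s.
  by rewrite -[4%N]/(2 * 2)%N dvdn_pmul2l // dvdn2.
have -> : (4 %| 3 * s)%N = (4 %| s)%N by rewrite Gauss_dvdr.
rewrite mul0n dvdn0 !mul1n.
apply/eqP; case: (odd s); case: (4 %| s)%N; case: b {key} => /=; ring.
Qed.

End ClassCount.

(** * Counting primes with the Hardy-Littlewood conjecture *)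

(** With [t] the fourth root of [n], the logarithm is at most [4 t], and the
    square root is [t ^ 2]. *)
Lemma ln_div_sqrt_cvg0 (R : realType) :
  ((ln (n%:R : R) / Num.sqrt n%:R) @[n --> \oo] --> (0 : R))%classic.
Proof.
pose t (n : nat) : R := Num.sqrt (Num.sqrt n%:R).
have t_oo : (t n @[n --> \oo] --> +oo)%classic.
  apply/cvgryPge => A; near=> n.
  have : (`|A| ^+ 4 <= n%:R :> R) by near: n; exact: nbhs_infty_ger.
  move=> hn; apply: (le_trans (ler_norm A)).
  have -> : `|A| = Num.sqrt (Num.sqrt (`|A| ^+ 4)).
    by rewrite -[4%N]/(2 * 2)%N exprM sqrtr_sqr [X in Num.sqrt X]ger0_norm
      ?sqr_ge0 // sqrtr_sqr normr_id.
  by rewrite /t !ler_wsqrtr.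
have t_inv : ((4 * (t n)^-1) @[n --> \oo] --> (0 : R))%classic.
  rewrite -[X in (_ --> X)%classic](mulr0 (4 : R)); apply: cvgMr.
  apply/gtr0_cvgV0 => //; near=> n.
  have n0 : (0 < n)%N by near: n; exact: nbhs_infty_gt.
  by rewrite /t !sqrtr_gt0 ltr0n.
apply: (squeeze_cvgr _ (cvg_cst (0 : R)) t_inv).
near=> n.
have n0 : (0 < n)%N by near: n; exact: nbhs_infty_gt.
have s0 : 0 < Num.sqrt (n%:R : R) by rewrite sqrtr_gt0 ltr0n.
have t0 : 0 < t n by rewrite /t sqrtr_gt0.
rewrite divr_ge0 ?(ltW s0) ?ln_ge0 ?ler1n //=.
have tt : Num.sqrt (n%:R : R) = t n ^+ 2 by rewrite /t sqr_sqrtr ?ltW.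
have nt : (n%:R : R) = t n ^+ 4.
  by rewrite -[4%N]/(2 * 2)%N exprM -tt sqr_sqrtr ?ler0n.
rewrite tt nt lnXn // ler_pdivrMr ?exprn_gt0 // -[ln _ *+ _]mulr_natl.
rewrite expr2 mulrA mulfVK ?gt_eqF // ler_pM2l //.
by rewrite ltW // ln_sublinear.
Unshelve. all: by end_near. Qed.

Section Density.
Variables (R : realType) (HL : Hardy_Littlewood R).
Variables (a m D : int) (M : nat) (T S : pred nat).
Hypotheses (a_odd : odd `|a|) (ma : m ^+ 2 = a ^+ 2).
Hypotheses (M_gt0 : (0 < M)%N) (M_even : ~~ odd M).
Hypothesis TE : forall r, T r = coprime `|(a ^+ 2 + r%:Z ^+ 2)%R| M.
Hypothesis M_dvd : forall p, prime p -> (p %| M)%N -> (p%:Z %| 2 * D)%Z.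
Hypothesis trace_S : forall p x, prime p -> p%:Z = a ^+ 2 + x%:Z ^+ 2 ->
  T (x %% M)%N ->
  ~~ (p%:Z %| 2 * D)%Z && (trace_E D p == 2 * m) = S (x %% M)%N.

(** The coefficients of [a ^ 2 + (r + M k) ^ 2] as a polynomial in [k]. *)
Definition hla : int := M%:Z ^+ 2.
Definition hlb (r : nat) : int := 2 * M%:Z * r%:Z.
Definition hlc (r : nat) : int := r%:Z ^+ 2 + a ^+ 2.

Definition class_count (r n : nat) : nat := HL_count hla (hlb r) (hlc r) n.

(** The Hardy-Littlewood constant sees the residue [r] neither through the
    discriminant nor through the primes that divide [M]. *)
Lemma HL_delta_const r :
  HL_delta R hla (hlb r) (hlc r) = HL_delta R hla (hlb 0) (hlc 0).
Proof.
rewrite /HL_delta; congr (_ * _ * _).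
- congr (_%:~R / _).
  have h k : gcdz 2 (hla + hlb k) = 2.
    apply: (elimT gcdz_idPl).
    rewrite /hla /hlb expr2 -[2 * _ * _]mulrA; apply: rpredD; last exact: dvdz_mulr.
    by apply: dvdz_mulr; rewrite dvdzE /= dvdn2.
  by rewrite !h.
- rewrite big_seq_cond [RHS]big_seq_cond; apply: eq_bigl => p.
  case: (boolP (p \in _)) => //= hp; congr (_ && _).
  move: hp; rewrite mem_primes => /and3P[pp _].
  rewrite -[X in (_ %| X)%N]/(M ^ 2)%N Euclid_dvdX // andbT => pM.
  have h k : (p%:Z %| hlb k)%Z.
    by rewrite /hlb -mulrA mulrCA; apply: dvdz_mulr; rewrite dvdzE.
  by rewrite !h.
- suff -> : disc hla (hlb r) (hlc r) = disc hla (hlb 0) (hlc 0) by [].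
  by rewrite /disc /hla /hlb /hlc; ring.
Qed.

Let delta : R := HL_delta R hla (hlb 0) (hlc 0).
Let g (n : nat) : R := delta * (Num.sqrt n%:R / ln n%:R).

Lemma class_count_cvg r : T r -> ((class_count r n)%:R / g n @[n --> \oo] --> (1 : R))%classic.
Proof.
rewrite TE => Tr; rewrite /g /delta -(HL_delta_const r).
have hM : 0 < M%:Z by rewrite ltz_nat.
have c_odd : ~~ (2 %| hlc r)%Z.
  rewrite /hlc addrC dvdzE; apply/negP => /= h2.
  move: Tr; rewrite /coprime => /eqP hg.
  have : (2 %| gcdn `|(a ^+ 2 + r%:Z ^+ 2)%R| M)%N by rewrite dvdn_gcd h2 dvdn2.
  by rewrite hg.
apply: HL.
- by rewrite /hla exprn_gt0.
- apply/eqP; rewrite -[1]/(1%N%:Z) /gcdz eqz_nat /=.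
  move: Tr; rewrite /coprime => /eqP hg.
  set d := gcdn _ _; have d1 : (d %| 1)%N.
    have dM : (d %| M ^ 2)%N.
      apply: dvdn_trans (dvdn_gcdl _ _) _; apply: dvdn_trans (dvdn_gcdl _ _) _.
      exact: dvdnn.
    have dc : (d %| `|(a ^+ 2 + r%:Z ^+ 2)%R|)%N.
      by rewrite addrC; exact: dvdn_gcdr.
    have cop : coprime `|(a ^+ 2 + r%:Z ^+ 2)%R| (M ^ 2) by rewrite coprimeXr // /coprime hg.
    by rewrite -(eqP cop) dvdn_gcd dM dc.
  by rewrite -dvdn1.
- by case=> _; rewrite (negbTE c_odd).
- case=> k; have a0 : a != 0 by apply: contraTneq a_odd => ->.
  have : disc hla (hlb r) (hlc r) < 0.
    have -> : disc hla (hlb r) (hlc r) = - (2 * M%:Z * a) ^+ 2.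
      by rewrite /disc /hla /hlb /hlc; ring.
    rewrite oppr_lt0 exprn_even_gt0 //= !mulf_neq0 //; lia.
  by move=> h e; move: h; rewrite e ltNge sqr_ge0.
Qed.

(** A zero constant would make the quotients of the conjecture identically 0,
    as division by 0 gives 0; their limit is 1. *)
Lemma delta_neq0 r : T r -> delta != 0.
Proof.
move=> /class_count_cvg h; apply/eqP => d0.
have : ((class_count r n)%:R / g n @[n --> \oo] --> (0 : R))%classic.
  under eq_fun => n do rewrite /g d0 mul0r invr0 mulr0.
  exact: cvg_cst.
move=> h0; have e : (1 : R) = 0.
  by rewrite -(cvg_lim (@Rhausdorff R) h) (cvg_lim (@Rhausdorff R) h0).
by move: (oner_neq0 R); rewrite e eqxx.
Qed.

Lemma class_countP r n (p : 'I_n) :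
  (p \in [set p : 'I_n | prime p &&
      `[< exists x : nat, p%:Z = hla * x%:Z ^+ 2 + hlb r * x%:Z + hlc r >]]%SET)
  = prime p && `[< exists x : nat, p%:Z = a ^+ 2 + (r + M * x)%N%:Z ^+ 2 >].
Proof.
rewrite inE; congr (_ && _); apply: asbool_equiv_eq.
by split=> -[x ->]; exists x; rewrite /hla /hlb /hlc PoszD PoszM; ring.
Qed.

Lemma gcd_class r p x : p%:Z = a ^+ 2 + (r + M * x)%N%:Z ^+ 2 ->
  coprime p M = T r.
Proof.
rewrite TE -!/(coprimez _ _) => hp.
have -> : coprime p M = coprimez p%:Z M%:Z by [].
have -> : coprime `|(a ^+ 2 + r%:Z ^+ 2)%R| M = coprimez (a ^+ 2 + r%:Z ^+ 2) M%:Z by [].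
have -> : p%:Z = (x%:Z * (2 * r%:Z + M%:Z * x%:Z)) * M%:Z + (a ^+ 2 + r%:Z ^+ 2).
  by rewrite hp PoszD PoszM; ring.
by rewrite /coprimez gcdzC gcdzMDl gcdzC.
Qed.

(** A prime in a class that is not coprime to [M] divides [M]. *)
Lemma class_count_bad r n : ~~ T r -> (class_count r n <= M.+1)%N.
Proof.
move=> Tr; rewrite /class_count /HL_count.
set A := finset _.
have h p : p \in A -> (p <= M)%N.
  rewrite class_countP => /andP[pp /asboolP[x hp]].
  apply: dvdn_leq => //; move: Tr; rewrite -(gcd_class hp).
  by rewrite prime_coprime // negbK.
pose u (p : 'I_n) : 'I_M.+1 := inord p.
rewrite -(card_in_imset (f := u)); first by rewrite -[X in (_ <= X)%N](card_ord M.+1) max_card.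
move=> p p' /h hp /h hp' /(congr1 val) /=.
by rewrite !inordK ?ltnS // => /val_inj.
Qed.

Lemma mem_Q N (p : 'I_N.+1) : p \in Q m N ->
  exists2 x : nat, prime p & p%:Z = a ^+ 2 + x%:Z ^+ 2.
Proof.
rewrite inE => /andP[pp /asboolP[x hx]]; exists `|x|%N => //.
by rewrite hx ma abszE real_normK ?num_real.
Qed.

(** Up to sign [x] is determined by [p], so each prime lies in the class of one
    residue only. *)
Lemma card_by_class (P : pred nat) N (A : {set 'I_N.+1}) :
  A \subset Q m N ->
  (forall (p : 'I_N.+1) x, prime p -> p%:Z = a ^+ 2 + x%:Z ^+ 2 ->
     (p \in A) = P (x %% M)%N) ->
  #|A| = (\sum_(r < M | P r) class_count r N.+1)%N.
Proof.
move=> AQ hA; rewrite -sum1_card big_mkcond.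
under [RHS]eq_bigr => r _ do rewrite /class_count /HL_count -sum1_card big_mkcond.
rewrite exchange_big; apply: eq_bigr => p _ /=.
under eq_bigr => r _ do rewrite class_countP.
case: (boolP (p \in Q m N)) => [/mem_Q[x pp hx]|pQ].
  rewrite (hA p x) // pp /= -big_mkcondr /=.
  rewrite (eq_bigl (fun r : 'I_M => P r && (r == Ordinal (ltn_pmod x M_gt0)))).
    case: ifP => hP; last first.
      rewrite big1 // => r /andP[Pr /eqP e].
      by move: Pr; rewrite e /= hP.
    rewrite (big_pred1 (Ordinal (ltn_pmod x M_gt0))) // => r /=.
    by case: eqP => [->|]; rewrite ?andbF //= hP.
  move=> r; congr (_ && _); apply/asboolP/eqP => [[y hy]|->].
    apply: val_inj => /=.
    have : x%:Z ^+ 2 = (r + M * y)%N%:Z ^+ 2 by apply: (addrI (a ^+ 2)); rewrite -hx.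
    move/eqP; rewrite eqf_sqr => xE.
    have -> : x = (r + M * y)%N by move: xE => /orP[]/eqP; lia.
    by rewrite mulnC addnC modnMDl modn_small.
  by exists (x %/ M)%N; rewrite hx /= {1}(divn_eq x M) addnC mulnC.
rewrite big1 => [|r _]; first by case: ifP => // /(fintype.subsetP AQ); rewrite (negbTE pQ).
case: ifP => // /andP[pp /asboolP[y hy]].
by case/negP: pQ; rewrite inE pp /=; apply/asboolP; exists (r + M * y)%N%:Z; rewrite ma.
Qed.

Lemma card_Q N : #|Q m N| = (\sum_(r < M) class_count r N.+1)%N.
Proof.
apply: (card_by_class (P := xpredT)) => // p x pp hp.
rewrite inE pp /=; apply/asboolP; exists x%:Z; by rewrite ma.
Qed.

Lemma card_Q_trace N :
  #|Q_trace D m N| = (\sum_(r < M | T r && S r) class_count r N.+1)%N.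
Proof.
apply: (card_by_class (P := fun r => T r && S r)).
  by apply/fintype.subsetP => p; rewrite inE => /andP[].
move=> p x pp hp; rewrite inE.
have -> : p \in Q m N.
  by rewrite inE pp /=; apply/asboolP; exists x%:Z; rewrite ma.
case: (boolP (T (x %% M)%N)) => [Tx|Tx] /=; first exact: trace_S.
have hp' : p%:Z = a ^+ 2 + (x %% M + M * (x %/ M))%N%:Z ^+ 2.
  by rewrite hp {1}(divn_eq x M) addnC mulnC.
move: Tx; rewrite -(gcd_class hp') prime_coprime // negbK => pM.
by rewrite M_dvd.
Qed.

(** Good classes contribute 1 each to the limit; the count of a bad class is
    bounded, while the absolute value of the denominator tends to
    infinity. *)
Lemma class_sum_cvg (P : pred nat) :
  (0 < #|[set r : 'I_M | T r]|)%N ->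
  (((\sum_(r < M | P r) class_count r n)%N%:R / g n) @[n --> \oo] -->
    (#|[set r : 'I_M | T r && P r]%SET|%:R : R))%classic.
Proof.
move=> /card_gt0P[r0]; rewrite inE => Tr0.
have d0 := delta_neq0 Tr0.
have ginv : ((g n)^-1 @[n --> \oo] --> (0 : R))%classic.
  rewrite -[X in (_ --> X)%classic](mulr0 delta^-1).
  under eq_fun => n do rewrite /g invfM invf_div.
  by apply: cvgMr; exact: ln_div_sqrt_cvg0.
have bad r : ~~ T r -> ((class_count r n)%:R / g n @[n --> \oo] --> (0 : R))%classic.
  move=> Tr; apply/cvgr0Pnorm_le => e e0; near=> n.
  have hM : `|(class_count r n)%:R / g n| <= M.+1%:R * `|(g n)^-1|.
    by rewrite normrM ger0_norm ?ler0n // ler_wpM2r // ler_nat class_count_bad.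
  apply: le_trans hM _; rewrite -ler_pdivlMl ?ltr0n //.
  near: n; move/cvgr0Pnorm_le: ginv; apply.
  by rewrite mulr_gt0 // invr_gt0 ltr0n.
have -> : (#|[set r : 'I_M | T r && P r]|%:R : R)
    = \sum_(r < M | P r) (if T r then 1 else 0).
  rewrite -big_mkcondr -sum1_card natr_sum; apply: eq_bigl => r.
  by rewrite inE andbC.
under eq_fun => n do rewrite natr_sum mulr_suml.
apply: cvg_big => [|r _]; [exact: add_continuous|]; case: ifP => [Tr|/negbT Tr]; first exact: class_count_cvg.
exact: bad.
Unshelve. all: by end_near. Qed.

(** Divide the two asymptotics. *)
Lemma density_of_classes : (0 < #|[set r : 'I_M | T r]|)%N ->
  dens D m (#|[set r : 'I_M | T r && S r]|%:R / #|[set r : 'I_M | T r]|%:R : R).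
Proof.
move=> T0; have := class_sum_cvg (P := fun r => T r && S r) T0.
have := class_sum_cvg (P := xpredT) T0.
have -> : [set r : 'I_M | T r && true] = [set r : 'I_M | T r].
  by apply/setP => r; rewrite !inE andbT.
have -> : [set r : 'I_M | T r && (T r && S r)] = [set r : 'I_M | T r && S r].
  by apply/setP => r; rewrite !inE andbA andbb.
rewrite -cvg_shiftS => hQ; rewrite -cvg_shiftS => hT.
pose uQ (n : nat) : R := (\sum_(r < M) class_count r n.+1)%N%:R / g n.+1.
pose uT (n : nat) : R := (\sum_(r < M | T r && S r) class_count r n.+1)%N%:R / g n.+1.
have {}hQ : (uQ n @[n --> \oo] --> (#|[set r : 'I_M | T r]%SET|%:R : R))%classic := hQ.
have {}hT : (uT n @[n --> \oo] -->
   (#|[set r : 'I_M | T r && S r]%SET|%:R : R))%classic := hT.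
have d0 : delta != 0.
  by have /card_gt0P[r] := T0; rewrite inE => /delta_neq0.
have c0 : (#|[set r : 'I_M | T r]|%:R : R) != 0 by rewrite pnatr_eq0 -lt0n.
apply: cvg_trans (cvgM hT (cvgV c0 hQ)); apply: near_eq_cvg.
near=> n; rewrite /= card_Q_trace card_Q /uT /uQ.
have g0 : g n.+1 != 0.
  rewrite /g mulf_neq0 // mulf_neq0 //.
  rewrite invr_eq0 ln_eq0 ?ltr0n // pnatr_eq1.
  have : (0 < n)%N by near: n; exact: nbhs_infty_gt.
  by case: (n).
by rewrite invf_div mulrA divfK.
Unshelve. all: by end_near. Qed.

End Density.

(** * The density as a product of local averages *)

Lemma local_value0_gt0 (a : int) (q : nat) : prime q -> odd q -> 0 < local_value a q 0.
Proof.
move=> qp qo; have q1 := prime_gt1 qp; rewrite /local_value /tau mul0n expr0 mulr1 dvdn0.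
by case: ifP => _; [lia | case: ifP => _; lia].
Qed.

Section LocalToGlobal.
Variables (R : realType) (HL : Hardy_Littlewood R).
Variables (a D : int) (L : seq (nat * nat)) (nu sigma : nat).
Hypotheses (ha : (a = 1 %[mod 4])%Z).
Hypotheses (Lp : all (fun z => prime z.1 && odd z.1) L).
Hypotheses (Lu : uniq (map fst L)) (Le : all (fun z => (0 < z.2)%N) L).
Hypothesis DE : D = (-1) ^+ nu * 2 ^+ sigma * \prod_(z <- L) qstar z.1 ^+ z.2.

Let s := (2 * nu + sigma)%N.

Definition value_ratio (q k : nat) : R :=
  (local_value a q k)%:~R / (local_value a q 0)%:~R.

Lemma modulus_gt0 : (0 < modulus L)%N.
Proof.
rewrite /modulus muln_gt0 /= big_seq prodn_cond_gt0 // => z /(allP Lp)/andP[].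
by move/prime_gt0.
Qed.

Lemma coprime_modulus (n : nat) : coprime n (modulus L) =
  odd n && all (fun z => ~~ (z.1 %| n)%N) L.
Proof.
rewrite /modulus coprimeMr -[8%N]/(2 ^ 3)%N coprime_pexpr // coprimen2.
congr (_ && _); elim: L Lp => [|z L' IH] /=; first by rewrite big_nil coprimen1.
move=> /andP[/andP[zp _] Lp']; rewrite big_cons coprimeMr IH //.
by rewrite coprime_sym prime_coprime.
Qed.

Lemma abs_D : `|D|%N = (2 ^ sigma * \prod_(z <- L) z.1 ^ z.2)%N.
Proof.
rewrite DE !abszM !abszX abszN1 exp1n mul1n; congr (_ * _)%N.
rewrite (big_morph absz abszM absz1); apply: eq_bigr => z _.
by rewrite abszX /qstar; case: ifP; rewrite ?abszN.
Qed.

Lemma dvd_modulus_D p : prime p -> (p %| modulus L)%N -> (p%:Z %| 2 * D)%Z.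
Proof.
move=> pp; rewrite dvdzE abszM /= abs_D => pM.
have : ~~ coprime p (modulus L) by rewrite prime_coprime // pM.
rewrite coprime_modulus negb_and => /orP[p2|/allPn[z zL]].
  have -> : p = 2%N by have [->|/(negP p2)] := even_prime pp.
  exact: dvdn_mulr.
have /andP[zp _] := allP Lp z zL; rewrite negbK dvdn_prime2 // => /eqP <-.
rewrite !dvdn_mull // (big_rem z) //= dvdn_mulr //.
by rewrite dvdn_exp // (allP Le).
Qed.

Lemma coprime_modulus_D p : prime p -> coprime p (modulus L) ->
  ~~ (p%:Z %| 2 * D)%Z.
Proof.
move=> pp; rewrite coprime_modulus => /andP[po hp].
rewrite dvdzE abszM /= abs_D -prime_coprime // !coprimeMr coprimen2 po.
rewrite coprimeXr ?coprimen2 //=; elim: L hp Lp => [|z L' IH] /=.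
  by rewrite big_nil coprimen1.
move=> /andP[hz hL] /andP[/andP[zp _] Lp']; rewrite big_cons coprimeMr IH // andbT.
by rewrite coprimeXr // coprime_sym prime_coprime.
Qed.

Lemma good_class_coprime r :
  good_class a L r = coprime `|(a ^+ 2 + r%:Z ^+ 2)%R| (modulus L).
Proof.
rewrite coprime_modulus /good_class; congr (_ && _).
have [k hk] := sqr_mod2 a; have [l hl] := sqr_mod2 r%:Z.
by move: ha; rewrite hk hl; clear; lia.
Qed.

Variable c : nat -> nat -> nat.
Hypothesis hc : forall z, z \in L -> is_local_symbol a z.1 (c z.1).

Lemma class_exp_mod x :
  class_exp L c s (x %% modulus L)%N = class_exp L c s x.
Proof.
rewrite /class_exp modn_dvdm ?dvdn_mulr //; congr (_ + _)%N.
apply: eq_big_seq => z zL; rewrite modn_dvdm //.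
by rewrite /modulus dvdn_mull // (big_rem z) //= dvdn_mulr.
Qed.

Lemma good_class_mod x :
  good_class a L (x %% modulus L)%N = good_class a L x.
Proof.
rewrite /good_class; congr (~~ _ && _).
  by rewrite [in RHS](divn_eq x (modulus L)) oddD !oddM andbF.
apply: eq_in_all => z zL; rewrite -(sqr_dvd_mod a z.1 (x %% _)) modn_dvdm.
  by rewrite sqr_dvd_mod.
by rewrite /modulus dvdn_mull // (big_rem z) //= dvdn_mulr.
Qed.

(** [D] is a product of [-1], [2] and the [qstar q], whose quartic characters
    are known. *)
Lemma D_quartic p x : prime p -> p%:Z = a ^+ 2 + x%:Z ^+ 2 ->
  good_class a L x ->
  (D%:~R : 'F_p) ^+ (p %/ 4) = rootN1 p a x%:Z ^+ class_exp L c s x.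
Proof.
move=> pp hp gx; have /andP[xe gL] := gx.
have hx' : (2 %| x%:Z)%Z by rewrite dvdzE /= dvdn2.
have hf := rootN1_sq pp hp ha hx'.
have pM : coprime p (modulus L) by rewrite -[p]/(`|p%:Z|%N) hp -good_class_coprime.
have fX t u : t = u %[mod 4] -> rootN1 p a x%:Z ^+ t = rootN1 p a x%:Z ^+ u.
  by move=> tu; rewrite -(expi_mod4 hf) tu expi_mod4.
rewrite DE !rmorphM !rmorphXn rmorphN1 /= [in LHS]exprMn [in LHS]exprMn /class_exp exprD.
congr (_ * _).
  rewrite exprAC (quartic_neg1 pp hp ha xe) [X in _ * X]exprAC (quartic_two pp hp ha xe).
  rewrite -!exprM -exprD; apply: fX; rewrite /s.
  have -> : (2 * (x %/ 2) * nu + x %/ 2 * sigma = (2 * nu + sigma) * (x %/ 2))%N by lia.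
  rewrite -[LHS]modnMmr -[RHS]modnMmr; congr ((_ * _) %% _)%N; lia.
rewrite rmorph_prod expr_sum -prodrXl; apply: eq_big_seq => z zL /=.
have [hz _] := hc zL.
have zp : z.1 != p; last by rewrite rmorphXn /= exprAC (hz p x pp hp xe zp) -exprM mulnC.
apply/negP => /eqP zp; move: pM; rewrite coprime_modulus => /andP[_ /allP /(_ z zL)].
by rewrite zp dvdnn.
Qed.

Lemma trace_class (b : bool) p x : prime p -> p%:Z = a ^+ 2 + x%:Z ^+ 2 ->
  good_class a L x ->
  (trace_E D p == 2 * ((-1) ^+ b * a)) = (class_exp L c s x %% 4 == 2 * b)%N.
Proof.
move=> pp hp gx; have /andP[xe _] := gx.
have hx' : (2 %| x%:Z)%Z by rewrite dvdzE /= dvdn2.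
have e := D_quartic pp hp gx.
case: b; rewrite ?expr1 ?mulN1r ?expr0 ?mul1r.
  exact: (trace_eq_N2alpha pp hp ha hx' e).
exact: (trace_eq_2alpha pp hp ha hx' e).
Qed.

Lemma value_prod0_gt0 : 0 < value_prod a L 0.
Proof.
rewrite /value_prod; elim: L Lp => [|z L' IH] /=; first by rewrite big_nil.
move=> /andP[/andP[zp zo] Lp']; rewrite big_cons mulr_gt0 ?IH //.
exact: local_value0_gt0.
Qed.

(** The three nontrivial powers of the quartic character contribute the products
    of their local averages: the square whenever its average over [x / 2] modulo
    4 does not vanish, that is for even [s], and the two other powers, with equal
    averages, if 4 divides [s]. *)
Lemma density_formula (b : bool) :
  dens D ((-1) ^+ b * a) (1 / 4 * (1 + (~~ odd s)%:R * \prod_(z <- L) value_ratio z.1 (2 * z.2)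
     + (-1) ^+ b * ((4 %| s)%N%:R * (2 * \prod_(z <- L) value_ratio z.1 z.2))) : R).
Proof.
have a_odd : odd `|a| by move: ha; clear; lia.
have V0 := value_prod0_gt0.
have cg := card_good_class s Lp Lu hc; have ce := card_class_exp s Lp Lu hc b.
pose T := good_class a L; pose S r := (class_exp L c s r %% 4 == 2 * b)%N.
have T0 : (0 < #|[set r : 'I_(modulus L) | T r]%SET|)%N.
  by rewrite -ltz_nat (cg : #|[set r : 'I_(modulus L) | T r]%SET|%:Z = _) pmulr_rgt0.
have M_even : ~~ odd (modulus L) by rewrite /modulus oddM.
have ma : ((-1) ^+ b * a) ^+ 2 = a ^+ 2 by rewrite exprMn sqrr_sign mul1r.
have key := @density_of_classes R HL a ((-1) ^+ b * a) D (modulus L) T S a_odd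
  ma modulus_gt0 M_even good_class_coprime dvd_modulus_D.
have {key} := key _ T0.
set v := (_ / _); set w := (X in _ -> dens _ _ X); suff -> : v = w.
  apply=> p x pp hp; rewrite /T /S good_class_mod class_exp_mod => gx.
  rewrite coprime_modulus_D //=; last by rewrite -[p]/(`|p%:Z|%N) hp -good_class_coprime.
  exact: trace_class.
have rat k : \prod_(z <- L) value_ratio z.1 (k * z.2)
    = (value_prod a L k)%:~R / (value_prod a L 0)%:~R.
  rewrite /value_ratio big_split /= prodfV !rmorph_prod /=.
  by congr (_ / _); apply: eq_bigr => z _; rewrite mul0n.
have rat1 : \prod_(z <- L) value_ratio z.1 z.2
    = (value_prod a L 1)%:~R / (value_prod a L 0)%:~R.
  by rewrite -rat; apply: eq_bigr => z _; rewrite mul1n.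
have V0R : (value_prod a L 0)%:~R != 0 :> R by rewrite intr_eq0 gt_eqF.
rewrite /v /w rat rat1.
have -> : #|[set r : 'I_(modulus L) | T r && S r]%SET|%:R
   = (#|[set r : 'I_(modulus L) | T r && S r]%SET|%:Z)%:~R :> R by [].
have -> : #|[set r : 'I_(modulus L) | T r]%SET|%:R
   = (#|[set r : 'I_(modulus L) | T r]%SET|%:Z)%:~R :> R by [].
rewrite ce cg; move: V0R.
rewrite !rmorphD !rmorphM !rmorphXn /= rmorphN1.
move: (value_prod a L 0)%:~R (value_prod a L 1)%:~R (value_prod a L 2)%:~R => x y z x0.
by field.
Qed.

End LocalToGlobal.

(** * Products over the prime factors of squarefree integers *)

Lemma odd_squarefree_prod n : odd_squarefree n -> n = (\prod_(q <- primes n) q)%N.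
Proof.
case=> n0 no sf; rewrite {1}(prod_prime_decomp n0) prime_decompE big_map.
apply: eq_big_seq => q; rewrite mem_primes => /and3P[qp _ qn] /=.
have l1 : (0 < logn q n)%N by rewrite logn_gt0 mem_primes qp n0.
have l2 : ~~ (2 <= logn q n)%N by rewrite -pfactor_dvdn // sf.
by have -> : logn q n = 1%N by [lia]; rewrite expn1.
Qed.

Lemma odd_primes n : odd n -> all (fun q => prime q && odd q) (primes n).
Proof.
move=> no; apply/allP => q; rewrite mem_primes => /and3P[-> _ qn].
exact: prime_odd_dvd no qn.
Qed.

Lemma uniq_flatten_primes (ns : seq nat) : pairwise coprime ns ->
  all (fun n => 0 < n)%N ns -> uniq (flatten [seq primes n | n <- ns]).
Proof.
elim: ns => //= n ns IH /andP[hn hns] /andP[n0 hns0].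
rewrite cat_uniq primes_uniq IH // andbT /=; apply/hasPn => q /flattenP[s].
case/mapP=> n' n'in ->; rewrite !mem_primes => /and3P[qp _ qn'].
rewrite qp n0 /=; apply/negP => qn.
have := allP hn n' n'in; rewrite /coprime => /eqP g1.
have : (q %| gcdn n n')%N by rewrite dvdn_gcd qn.
by rewrite g1 dvdn1 => /eqP q1; move: qp; rewrite q1.
Qed.

Lemma prod_tauM m n : coprime m n -> (0 < m)%N -> (0 < n)%N ->
  prod_tau (m * n) = (prod_tau m * prod_tau n)%N.
Proof.
move=> cop m0 n0; rewrite /prod_tau -big_cat; apply: perm_big.
apply: uniq_perm; rewrite ?primes_uniq //.
  have := @uniq_flatten_primes [:: m; n]; rewrite /= !andbT cats0; apply => //.
  by rewrite m0.
by move=> q; rewrite primesM // mem_cat.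
Qed.

(** The exponent of -1 needed to replace primes that are 3 modulo 4 by their
    negatives. *)
Definition qstar_sign (L : seq (nat * nat)) : nat :=
  (\sum_(z <- L) (z.1 %% 4 != 1) * z.2)%N.

Lemma prod_qstar (L : seq (nat * nat)) :
  (\prod_(z <- L) z.1%:Z ^+ z.2) =
  (-1) ^+ qstar_sign L * \prod_(z <- L) qstar z.1 ^+ z.2.
Proof.
rewrite /qstar_sign expr_sum -big_split /=; apply: eq_bigr => z _.
rewrite exprM -exprMn; congr (_ ^+ _); rewrite /qstar.
by case: eqP => _ /=; rewrite ?expr0 ?expr1 ?mul1r // mulN1r opprK.
Qed.

Lemma prod_qstar_mod4 (L : seq (nat * nat)) : all (fun z => odd z.1) L ->
  exists t : int, \prod_(z <- L) qstar z.1 ^+ z.2 = 4 * t + 1.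
Proof.
elim: L => [|z L IH] /=; first by rewrite big_nil; exists 0.
move=> /andP[zo /IH[t ht]]; rewrite big_cons ht.
have [u ->] : exists u, qstar z.1 = 4 * u + 1.
  by rewrite /qstar; case: eqP => h; [exists (z.1 %/ 4)%N%:Z | exists (- (z.1 %/ 4).+1%:Z)];
    move: zo h; clear; lia.
have [v ->] : exists v, (4 * u + 1) ^+ z.2 = 4 * v + 1.
  elim: z.2 => [|k [v hv]]; first by exists 0; rewrite expr0.
  by rewrite exprS hv; exists (4 * u * v + u + v); ring.
by exists (4 * v * t + v + t); ring.
Qed.

Section Blocks.
Variables (R : realType) (a : int) (n : nat).
Hypotheses (no : odd n).

Lemma value_ratio_ramified q k : prime q -> (q%:Z %| a)%Z ->
  value_ratio R a q k = (-1) ^+ (k * pm3_mod8 q).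
Proof.
move=> qp qa; rewrite /value_ratio /local_value qa mul0n expr0 mulr1 rmorphM.
rewrite rmorphXn rmorphN1 mulrC mulKf // intr_eq0.
by have := prime_gt1 qp; clear; lia.
Qed.

Lemma value_ratio_unramified q k : prime q -> odd q -> ~~ (q%:Z %| a)%Z ->
  value_ratio R a q k =
  if (4 %| k)%N then 1 else - (-1) ^+ (k * pm3_mod8 q) / (tau q)%:R.
Proof.
move=> qp qo qa; have := local_value0_gt0 a qp qo.
rewrite /value_ratio /local_value (negbTE qa) mul0n dvdn0 => t0.
case: ifP => _; first by rewrite divff // intr_eq0 gt_eqF.
by rewrite rmorphN rmorphXn rmorphN1.
Qed.

Lemma count_pm3 : count pm3_mod8 (primes n) = (nprimes8 3 n + nprimes8 5 n)%N.
Proof.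
rewrite /nprimes8 -count_predUI -[LHS]addn0; congr (_ + _)%N.
by apply/esym/eqP; rewrite -leqn0 leqNgt -has_count; apply/hasPn => q _ /=; clear; lia.
Qed.

Lemma count_pm1 :
  (nprimes n = count pm3_mod8 (primes n) + (nprimes8 1 n + nprimes8 7 n))%N.
Proof.
rewrite /nprimes -(count_predC pm3_mod8); congr (_ + _)%N.
rewrite /nprimes8 -count_predUI -[LHS]addn0; congr (_ + _)%N.
  apply: eq_in_count => q /(allP (odd_primes no))/andP[_ qo].
  by move: qo; rewrite /= /pm3_mod8; clear; lia.
by apply/esym/eqP; rewrite -leqn0 leqNgt -has_count; apply/hasPn => q _ /=; clear; lia.
Qed.

Lemma prod_signs (T : pred nat) (s : seq nat) :
  \prod_(q <- s) ((-1) ^+ (T q)) = (-1) ^+ count T s :> R.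
Proof.
by elim: s => [|q s IH]; rewrite ?big_nil ?big_cons // IH -exprD.
Qed.

Lemma block_ramified k : (forall q, prime q -> (q %| n)%N -> (q%:Z %| a)%Z) ->
  \prod_(q <- primes n) value_ratio R a q k =
  (-1) ^+ (k * (nprimes8 3 n + nprimes8 5 n)).
Proof.
move=> hn; rewrite -count_pm3 mulnC exprM -prod_signs -prodrXl.
apply: eq_big_seq => q; rewrite mem_primes => /and3P[qp _ qn].
by rewrite value_ratio_ramified ?hn // mulnC exprM.
Qed.

Lemma block_unramified k :
  (forall q, prime q -> (q %| n)%N -> ~~ (q%:Z %| a)%Z) -> ~~ (4 %| k)%N ->
  \prod_(q <- primes n) value_ratio R a q k =
  (-1) ^+ (if odd k then nprimes8 1 n + nprimes8 7 n else nprimes n)%N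
   / (prod_tau n)%:R.
Proof.
move=> hn hk.
have -> : (-1) ^+ (if odd k then nprimes8 1 n + nprimes8 7 n else nprimes n)%N
    = (-1) ^+ (nprimes n) * \prod_(q <- primes n) (-1) ^+ (k * pm3_mod8 q) :> R.
  have -> : \prod_(q <- primes n) (-1) ^+ (k * pm3_mod8 q)
      = (-1) ^+ (k * count pm3_mod8 (primes n)) :> R.
    rewrite [in RHS]mulnC exprM -prod_signs -prodrXl.
    by apply: eq_bigr => q _; rewrite mulnC exprM.
  rewrite -exprD -signr_odd -[RHS]signr_odd !oddD oddM.
  congr (_ ^+ nat_of_bool _); case: (odd k) => /=; last by rewrite addbF.
  rewrite count_pm1 !oddD.
  by case: (odd (count _ _)); case: (odd (nprimes8 1 n)); case: (odd (nprimes8 7 n)).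
rewrite /nprimes -(count_predT (primes n)) -prod_signs /prod_tau natr_prod -prodfV.
rewrite -!big_split /=; apply: eq_big_seq => q qs.
have /andP[qp qo] := allP (odd_primes no) q qs.
move: qs; rewrite mem_primes => /and3P[_ _ qn].
by rewrite value_ratio_unramified ?hn // (negbTE hk) expr1 mulN1r.
Qed.

End Blocks.

Definition block (k n : nat) : seq (nat * nat) := [seq (q, k) | q <- primes n].

Lemma big_block (V : Type) (idx : V) (op : Monoid.law idx) (F : nat * nat -> V) k n :
  \big[op/idx]_(z <- block k n) F z = \big[op/idx]_(q <- primes n) F (q, k).
Proof. by rewrite big_map. Qed.

Lemma prod_block k n : odd_squarefree n ->
  \prod_(z <- block k n) z.1%:Z ^+ z.2 = n%:Z ^+ k.
Proof.
move=> hn; rewrite big_map /= prodrXl {2}(odd_squarefree_prod hn).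
by rewrite (big_morph Posz PoszM (erefl (Posz 1))).
Qed.

(** The primes of [d] divide [alpha] and those of [d'] do not, so the former
    contribute signs only, and the latter the factors [1 / tau].  The integer
    [nu] is fixed modulo 2 by the class modulo 4 of the odd part of [D]. *)
Lemma density_of_splitting (R : realType) (HL : Hardy_Littlewood R)
    (alpha : int) (halpha : (alpha = 1 %[mod 4])%Z)
    (D : int) (neg : bool) (sigma : nat)
    (d : nat) (d' : int) (dp dq dl dp' dq' dl' : nat)
    (hsplit : alpha_splitting alpha D neg sigma d d' dp dq dl dp' dq' dl') :
  let e := (nprimes8 3 dp + nprimes8 5 dp + nprimes8 3 dl + nprimes8 5 dl
            + nprimes8 1 dp' + nprimes8 7 dp' + nprimes8 1 dl' + nprimes8 7 dl'
            + nprimes dq')%N in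
  let A : R := (-1) ^+ (nprimes dp' + nprimes dl') / (prod_tau (dp' * dl'))%:R in
  let B : R := 2 * (-1) ^+ e / (prod_tau (dp' * dq' * dl'))%:R in
  exists nu : nat, exists t : int,
   D = (-1) ^+ nu * 2 ^+ sigma * (4 * t + 1) /\
   forall b : bool, dens D ((-1) ^+ b * alpha)
     (1 / 4 * (1 + (~~ odd sigma)%:R * A
        + (-1) ^+ b * ((4 %| 2 * nu + sigma)%N%:R * B))).
Proof.
move=> e A B.
case: hsplit => [[hD _ _ _] [hd [hd' [dE [d'E [hsf hcop]]]]]].
have [sf1 sf2 sf3] : [/\ odd_squarefree dp, odd_squarefree dq & odd_squarefree dl].
  by split; apply: hsf; rewrite !inE eqxx ?orbT.
have [sf4 sf5 sf6] : [/\ odd_squarefree dp', odd_squarefree dq' & odd_squarefree dl'].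
  by split; apply: hsf; rewrite !inE eqxx ?orbT.
pose L := block 1 dp ++ block 2 dq ++ block 3 dl ++ block 1 dp' ++ block 2 dq' ++ block 3 dl'.
have fb k n : map fst (block k n) = primes n by rewrite /block -map_comp map_id.
have Lp : all (fun z => prime z.1 && odd z.1) L.
  have P k n : odd_squarefree n -> all (fun z => prime z.1 && odd z.1) (block k n).
    by case=> _ no _; rewrite all_map; exact: odd_primes.
  by rewrite /L !all_cat !P.
have Lu : uniq (map fst L).
  have -> : map fst L = flatten [seq primes n | n <- [:: dp; dq; dl; dp'; dq'; dl']].
    by rewrite /L !map_cat !fb /= cats0.
  apply: uniq_flatten_primes => //=.
  by case: sf1 sf2 sf3 sf4 sf5 sf6 => [-> _ _] [-> _ _] [-> _ _] [-> _ _] [-> _ _] [-> _ _].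
have Le : all (fun z => (0 < z.2)%N) L.
  have P k n : (0 < k)%N -> all (fun z => (0 < z.2)%N) (block k n).
    by move=> k0; rewrite all_map; apply/allP.
  by rewrite /L !all_cat !P.
pose nu := (neg + qstar_sign L)%N.
have DE : D = (-1) ^+ nu * 2 ^+ sigma * \prod_(z <- L) qstar z.1 ^+ z.2.
  have -> : (-1) ^+ nu * 2 ^+ sigma * \prod_(z <- L) qstar z.1 ^+ z.2
      = (-1) ^+ neg * 2 ^+ sigma * \prod_(z <- L) z.1%:Z ^+ z.2.
    by rewrite prod_qstar exprD; ring.
  rewrite /L !big_cat /= !prod_block // hD dE d'E !expnS !expn0 !muln1 !PoszM; ring.
have Lo : all (fun z => odd z.1) L by apply: sub_all Lp => z /andP[].
have [t ht] := prod_qstar_mod4 Lo.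
exists nu, t; split; first by rewrite -ht.
have exc q : exists c, prime q && odd q -> is_local_symbol alpha q c.
  case: (boolP (prime q && odd q)) => [/andP[qp qo]|_]; last by exists id.
  by have [c hc] := exists_local_symbol halpha qp qo; exists c.
have [c hc0] := choice exc.
have hc z : z \in L -> is_local_symbol alpha z.1 (c z.1).
  by move=> /(allP Lp) /hc0.
move=> b; have := density_formula HL halpha Lp Lu Le DE hc (b := b).
have ram n : (n %| d)%N -> forall q, prime q -> (q %| n)%N -> (q%:Z %| alpha)%Z.
  by move=> nd q qp qn; apply: hd => //; exact: dvdn_trans qn nd.
have unram n : (n%:Z %| d')%Z ->
    forall q, prime q -> (q %| n)%N -> ~~ (q%:Z %| alpha)%Z.
  move=> nd q qp qn; apply/negP => qa.
  have : (q %| gcdn `|alpha| `|d'|)%N.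
    by rewrite dvdn_gcd -[(q %| `|alpha|)%N]/((q%:Z %| alpha)%Z) qa (dvdn_trans qn).
  move: hd'; rewrite /coprimez /gcdz eqz_nat => /eqP ->; rewrite dvdn1 => /eqP q1.
  by move: qp; rewrite q1.
have r1 : (dp %| d)%N by rewrite dE -mulnA dvdn_mulr.
have r2 : (dq %| d)%N by rewrite dE dvdn_mulr // dvdn_mull // dvdn_exp.
have r3 : (dl %| d)%N by rewrite dE dvdn_mull // dvdn_exp.
have u1 : (dp'%:Z %| d')%Z by rewrite d'E; do 2! apply: dvdz_mulr; exact: dvdz_mull.
have u2 : (dq'%:Z %| d')%Z by rewrite d'E; apply: dvdz_mulr; apply: dvdz_mull; exact: dvdz_mulr.
have u3 : (dl'%:Z %| d')%Z by rewrite d'E; apply: dvdz_mull; exact: dvdz_mulr.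
have no n : odd_squarefree n -> odd n by case.
have unram4 n : (n%:Z %| d')%Z -> odd_squarefree n ->
    \prod_(q <- primes n) value_ratio R alpha q 4 = 1.
  move=> nd /no n_odd; rewrite big1_seq // => q /andP[_ qn].
  have /andP[qp qo] := allP (odd_primes n_odd) q qn.
  by rewrite value_ratio_unramified // (unram n nd) //; move: qn; rewrite mem_primes => /and3P[].
have s2 k : (-1) ^+ (2 * k) = 1 :> R by rewrite exprM sqrrN expr1n expr1n.
have s3 k : (-1) ^+ (3 * k) = (-1) ^+ k :> R by rewrite -signr_odd oddM signr_odd.
have n0 n : odd_squarefree n -> (0 < n)%N by case.
have [c12 c13 c23] : [/\ coprime dp' dq', coprime dp' dl' & coprime dq' dl'].
  by move: hcop => /= /and5P[_ _ _ /and3P[-> -> _] /andP[/andP[-> _] _]].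
have RA n k : (n %| d)%N -> \prod_(q <- primes n) value_ratio R alpha q k =
    (-1) ^+ (k * (nprimes8 3 n + nprimes8 5 n)).
  by move=> nd; apply: block_ramified; exact: (ram n nd).
have UN n k : (n%:Z %| d')%Z -> odd_squarefree n -> ~~ (4 %| k)%N ->
    \prod_(q <- primes n) value_ratio R alpha q k =
    (-1) ^+ (if odd k then nprimes8 1 n + nprimes8 7 n else nprimes n)%N
      / (prod_tau n)%:R.
  by move=> nd /no n_odd hk; apply: block_unramified => //; exact: (unram n nd).
have -> : \prod_(z <- L) value_ratio R alpha z.1 (2 * z.2) = A.
  rewrite /L !big_cat !big_block /= -[(2 * 1)%N]/2%N -[(2 * 2)%N]/4%N -[(2 * 3)%N]/6%N.
  rewrite (RA _ _ r1) (RA _ _ r2) (RA _ _ r3) (unram4 _ u2 sf5).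
  rewrite (UN _ _ u1 sf4) // (UN _ _ u3 sf6) //=.
  rewrite -[4%N]/(2 * 2)%N -[6%N]/(2 * 3)%N -!mulnA !s2 !mul1r /A.
  by rewrite prod_tauM ?n0 // natrM exprD mulf_div.
have -> : 2 * \prod_(z <- L) value_ratio R alpha z.1 z.2 = B.
  rewrite /L !big_cat !big_block /=.
  rewrite (RA _ _ r1) (RA _ _ r2) (RA _ _ r3).
  rewrite (UN _ _ u1 sf4) // (UN _ _ u2 sf5) // (UN _ _ u3 sf6) //=.
  rewrite mul1n s2 s3 mul1r /B prod_tauM ?muln_gt0 ?n0 //; last by rewrite coprimeMl c13.
  rewrite prod_tauM ?n0 // !natrM !invfM /e !exprD; ring.
by rewrite oddD oddM.
Qed.

Theorem theorem3p13 (R : realType) (HL : Hardy_Littlewood R)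
    (alpha : int) (halpha : (alpha = 1 %[mod 4])%Z)
    (D : int) (neg : bool) (sigma : nat) (ps qs ls : seq nat)
    (hD : standard_form D neg sigma ps qs ls)
    (d : nat) (d' : int) (dp dq dl dp' dq' dl' : nat)
    (hsplit : alpha_splitting alpha D neg sigma d d' dp dq dl dp' dq' dl') :
  let r'' := nprimes dp' in
  let s'' := nprimes dq' in
  let t'' := nprimes dl' in
  let e := (nprimes8 3 dp + nprimes8 5 dp + nprimes8 3 dl + nprimes8 5 dl
            + nprimes8 1 dp' + nprimes8 7 dp' + nprimes8 1 dl' + nprimes8 7 dl'
            + s'')%N in
  let A : R := (-1) ^+ (r'' + t'') / (prod_tau (dp' * dl'))%:R in
  let B : R := 2 * (-1) ^+ e / (prod_tau (dp' * dq' * dl'))%:R in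
  ((~~ (2 %| D)%Z ->
      ((D = 1 %[mod 4])%Z ->
         dens D alpha (1 / 4 * (1 + A + B)) /\
         dens D (- alpha) (1 / 4 * (1 + A - B)))
      /\
      ((D = 3 %[mod 4])%Z ->
         dens D alpha (1 / 4 * (1 + A)) /\
         dens D (- alpha) (1 / 4 * (1 + A))))
   /\
   ((2 %| D)%Z ->
      (exactly_divides 2 D -> ((D %/ 4)%Z = 1 %[mod 4])%Z ->
         dens D alpha (1 / 4 * (1 + A)) /\
         dens D (- alpha) (1 / 4 * (1 + A)))
      /\
      (exactly_divides 2 D -> ((D %/ 4)%Z = 3 %[mod 4])%Z ->
         dens D alpha (1 / 4 * (1 + A + B)) /\
         dens D (- alpha) (1 / 4 * (1 + A - B)))
      /\
      (exactly_divides 1 D \/ exactly_divides 3 D ->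
         dens D alpha (1 / 4 : R) /\ dens D (- alpha) (1 / 4 : R)))).
Proof.
move=> r'' s'' t'' e A B.
have [sigma3 _ _ _] := hD.
have [nu [t [DE key]]] := density_of_splitting HL halpha hsplit.
have dens_pm (x y : bool) : ~~ odd sigma = x -> (4 %| 2 * nu + sigma)%N = y ->
    dens D alpha (1 / 4 * (1 + x%:R * A + y%:R * B)) /\
    dens D (- alpha) (1 / 4 * (1 + x%:R * A - y%:R * B)).
  move=> <- <-; have := key false; have := key true.
  by rewrite expr1 expr0 !mulN1r !mul1r.
have pow k : (2 ^+ k.+1 : int) = 2 * 2 ^+ k by rewrite exprS.
have Dodd : ~~ (2 %| D)%Z -> sigma = 0%N.
  case: (sigma) DE => // k ->; rewrite pow => /negP []; apply: dvdz_mulr.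
  by apply: dvdz_mull; exact: dvdz_mulr.
have Deven k : sigma = k.+1 -> (2 %| D)%Z.
  by move=> sE; rewrite DE sE pow; apply: dvdz_mulr; apply: dvdz_mull; exact: dvdz_mulr.
have {}DE : D = 2 ^+ sigma * ((-1) ^+ odd nu * (4 * t + 1)).
  by rewrite DE -[in LHS]signr_odd; ring.
have pow2 : (2 ^+ 2 : int) = 4 by [].
have exact k : (k <= 3)%N -> exactly_divides k D -> sigma = k.
  have [v ->] : exists v, D = 2 ^+ sigma * (2 * v + 1).
    rewrite DE; case: (odd nu); [exists (- 2 * t - 1) | exists (2 * t)];
      rewrite ?expr1 ?expr0; ring.
  rewrite /exactly_divides; case: (sigma) sigma3 => [|[|[|[|]]]] // _;
    case: k => [|[|[|[|]]]] // _; rewrite !exprS !expr0 !mulr1 ?mul1r; clear; lia.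
have nu4 : (4 %| 2 * nu)%N = ~~ odd nu by lia.
have nu42 : (4 %| 2 * nu + 2)%N = odd nu by lia.
split=> [Do | De]; [split=> [D1|D3] | split=> [D4 D1|]; last split=> [D4 D3|D13]].
- have s0 := Dodd Do; have no : odd nu = false.
    by move: D1; rewrite DE s0 expr0 mul1r; case: (odd nu) => //; rewrite expr1 mulN1r; clear; lia.
  have := dens_pm true true; rewrite s0 addn0 nu4 no !mul1r; exact.
- have s0 := Dodd Do; have no : odd nu = true.
    by move: D3; rewrite DE s0 expr0 mul1r; case: (odd nu) => //; rewrite expr0 mul1r; clear; lia.
  have := dens_pm true false; rewrite s0 addn0 nu4 no !mul1r !mul0r subr0 addr0; exact.
- have s2 := exact 2%N isT D4.
  have no : odd nu = false.
    by move: D1; rewrite DE s2 pow2; case: (odd nu) => //; rewrite expr1 mulN1r; clear; lia.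
  have := dens_pm true false; rewrite s2 nu42 no !mul1r !mul0r subr0 addr0; exact.
- have s2 := exact 2%N isT D4.
  have no : odd nu = true.
    by move: D3; rewrite DE s2 pow2; case: (odd nu) => //; rewrite expr0 mul1r; clear; lia.
  have := dens_pm true true; rewrite s2 nu42 no !mul1r; exact.
- have so : odd sigma.
    by case: D13 => [/(exact 1%N isT)|/(exact 3%N isT)] ->.
  have := dens_pm false false; rewrite so; have -> : (4 %| 2 * nu + sigma)%N = false by lia.
  rewrite !mul0r subr0 !addr0 mulr1; exact.
Qed.
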